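(* Let $B=B(G,\underline g,\underline\chi)$ be a quantum linear space bosonization (QLS) of rank $\theta$ over $\Bbbk$ and let $R$ be a left $B$-module algebra. The smash product $R\# B$ is semiprime if and only if, after possibly reordering the indices $1,\dots,\theta$ (that is, for some simultaneous permutation of the triples $(g_i,\chi_i,x_i)$), the following three conditions hold: (1) $\bigcap_{i=1}^\theta R^{\langle x_i\rangle}$ is semiprime; (2) $x_\theta(L)\neq 0$ for all nonzero left ideals $L$ of $R$; (3) for all $k\in\{1,\dots,\theta-1\}$, $x_k(L)\neq 0$ for all nonzero left ideals $L$ of the ring $\bigcap_{j=k+1}^\theta R^{\langle x_j\rangle}$.
   Context: $\Bbbk$ is an algebraically closed field of characteristic zero; all algebras are associative unital $\Bbbk$-algebras and tensor products are over $\Bbbk$. For a group $G$, $\widehat G=\mathrm{Hom}(G,\Bbbk^\times)$. QLS: let $\theta$ be a positive integer, $G$ a finite abelian group, $\underline g=g_1,\dots,g_\theta\in G$ (repetitions allowed, not necessarily generating $G$), $\underline\chi=\chi_1,\dots,\chi_\theta\in\widehat G$, with $m_i=\mathrm{ord}(\chi_i(g_i))\ge 2$ (order in $\Bbbk^\times$) and $\chi_i(g_j)\chi_j(g_i)=1$ for $i\ne j$. The bosonization of a quantum linear space over $G$ (QLS), of rank $\theta$, is the Hopf algebra $B(G,\underline g,\underline\chi)$ generated over $\Bbbk$ by the grouplikes $G$ and $(g_i,1)$-skew-primitive elements $x_1,\dots,x_\theta$ (so $\Delta(x_i)=g_i\otimes x_i+x_i\otimes 1$) with relations (besides those of $G$)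 $gx_i=\chi_i(g)x_ig$, $x_i^{m_i}=0$, $x_ix_j=\chi_j(g_i)x_jx_i$ for all $g\in G$ and all $i\neq j$. A left $H$-module algebra $R$ over a Hopf algebra $H$ is an algebra that is a left $H$-module with $h\cdot 1_R=\varepsilon(h)1_R$ and $h\cdot(rr')=\sum(h_1\cdot r)(h_2\cdot r')$. The smash product $R\#H$ is $R\otimes H$ as a vector space with multiplication $(r\#h)(r'\#h')=\sum r(h_1\cdot r')\#h_2h'$. We write $h(r)$ for $h\cdot r$. $R^{\langle x_i\rangle}=\{r\in R: x_i(r)=0\}$, a subalgebra of $R$. *)

(* Defs.v *)
From HB Require Import structures.
From mathcomp Require Import all_boot all_order all_algebra all_fingroup.
From mathcomp Require Import boolp classical_sets.

Set Implicit Arguments.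
Unset Strict Implicit.
Unset Printing Implicit Defensive.

Import GRing.Theory.
Local Open Scope ring_scope.
Local Open Scope quotient_scope.

Section LinearTheory.
Context (K : fieldType) (U V : lmodType K) (f : U -> V).
Hypothesis lf : linear f.

Lemma linear_D u v : f (u + v) = f u + f v.
Proof.
have : f (1 *: u + v) = 1 *: f u + f v by apply: lf.
by rewrite !scale1r.
Qed.
Lemma linear_0 : f 0 = 0.
Proof. by apply: (addrI (f 0)); rewrite -linear_D !addr0. Qed.
Lemma linear_Z a u : f (a *: u) = a *: f u.
Proof.
have : f (a *: u + 0) = a *: f u + f 0 by apply: lf.
by rewrite linear_0 !addr0.
Qed.
End LinearTheory.

Notation bilin f := (bilinear_for *:%R *:%R f).

Section BilinTheory.
Context (K : fieldType) (V W U : lmodType K) (f : V -> W -> U).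
Hypothesis bf : bilin f.

Lemma bilin_Pl a v v' w : f (a *: v + v') w = a *: f v w + f v' w.
Proof. exact: (bf.1 w). Qed.
Lemma bilin_Pr a v w w' : f v (a *: w + w') = a *: f v w + f v w'.
Proof. exact: (bf.2 v). Qed.
Lemma bilin_Dl v v' w : f (v + v') w = f v w + f v' w.
Proof. by have := bilin_Pl 1 v v' w; rewrite !scale1r. Qed.
Lemma bilin_Dr v w w' : f v (w + w') = f v w + f v w'.
Proof. by have := bilin_Pr 1 v w w'; rewrite !scale1r. Qed.
Lemma bilin_0l w : f 0 w = 0.
Proof. by apply: (addrI (f 0 w)); rewrite -bilin_Dl !addr0. Qed.
Lemma bilin_0r v : f v 0 = 0.
Proof. by apply: (addrI (f v 0)); rewrite -bilin_Dr !addr0. Qed.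
Lemma bilin_Zl a v w : f (a *: v) w = a *: f v w.
Proof. by have := bilin_Pl a v 0 w; rewrite bilin_0l !addr0. Qed.
Lemma bilin_Zr a v w : f v (a *: w) = a *: f v w.
Proof. by have := bilin_Pr a v w 0; rewrite bilin_0r !addr0. Qed.
End BilinTheory.

Lemma bilinI (K : fieldType) (V W U : lmodType K) (f : V -> W -> U) :
  (forall v v' w, f (v + v') w = f v w + f v' w) ->
  (forall v w w', f v (w + w') = f v w + f v w') ->
  (forall a v w, f (a *: v) w = a *: f v w) ->
  (forall a v w, f v (a *: w) = a *: f v w) -> bilin f.
Proof.
move=> Dl Dr Zl Zr; split.
  by move=> w a v v'; rewrite /= Dl Zl.
by move=> v a w w'; rewrite Dr Zr.
Qed.

(* The tensor product over K: finite formal sums of pairs (v, w), two of them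
   being identified when every bilinear map takes the same value on them. *)
Section TensorDef.
Context (K : fieldType) (V W : lmodType K).

Definition fsum (U : lmodType K) (f : V -> W -> U) (s : seq (V * W)) : U :=
  \sum_(p <- s) f p.1 p.2.

Definition tens_eq (s t : seq (V * W)) : bool :=
  `[< forall (U : lmodType K) (f : V -> W -> U), bilin f ->
        fsum f s = fsum f t >].

Lemma tens_eq_refl : reflexive tens_eq.
Proof. by move=> s; apply/asboolP. Qed.

Lemma tens_eq_sym : symmetric tens_eq.
Proof.
by move=> s t; apply/asboolP/asboolP => st U f bf; rewrite (st U f bf).
Qed.

Lemma tens_eq_trans : transitive tens_eq.
Proof.
move=> s t u /asboolP ts /asboolP su; apply/asboolP => U f bf.
by rewrite (ts U f bf) (su U f bf).
Qed.

Canonical tens_equiv := EquivRel tens_eq tens_eq_refl tens_eq_sym tens_eq_trans.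

Definition tens : Type := {eq_quot tens_equiv}.
HB.instance Definition _ := Choice.on tens.

Definition mktens (s : seq (V * W)) : tens := \pi_{eq_quot tens_equiv} s.
Definition tseq (t : tens) : seq (V * W) :=
  generic_quotient.repr (t : {eq_quot tens_equiv}).

Lemma tseqK t : mktens (tseq t) = t.
Proof. exact: reprK. Qed.

Definition pure (v : V) (w : W) : tens := mktens [:: (v, w)].

(* The linear map on the tensor product induced by f; only meaningful when f is
   bilinear. *)
Definition tlift (U : lmodType K) (f : V -> W -> U) (t : tens) : U :=
  fsum f (tseq t).

Lemma tlift_pi (U : lmodType K) (f : V -> W -> U) s : bilin f ->
  tlift f (mktens s) = fsum f s.
Proof.
move=> bf; rewrite /tlift /tseq /mktens; case: piP => s' /eqmodP /asboolP ss'.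
by rewrite (ss' U f bf).
Qed.

Lemma tensP (t u : tens) :
  (forall (U : lmodType K) (f : V -> W -> U), bilin f -> tlift f t = tlift f u) ->
  t = u.
Proof.
rewrite -[t]tseqK -[u]tseqK => tu.
by apply/eqmodP/asboolP => U f bf; rewrite -!tlift_pi ?tu.
Qed.

Definition tzero : tens := mktens [::].
Definition tadd (t u : tens) : tens :=
  mktens (tseq t ++ tseq u).
Definition tscale (a : K) (t : tens) : tens :=
  mktens [seq (a *: p.1, p.2) | p <- tseq t].
Definition topp (t : tens) : tens := tscale (-1) t.

Lemma tlift_tzero (U : lmodType K) (f : V -> W -> U) : bilin f ->
  tlift f tzero = 0.
Proof. by move=> bf; rewrite tlift_pi // /fsum big_nil. Qed.

Lemma tlift_tadd (U : lmodType K) (f : V -> W -> U) t u : bilin f ->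
  tlift f (tadd t u) = tlift f t + tlift f u.
Proof. by move=> bf; rewrite tlift_pi // /fsum big_cat. Qed.

Lemma tlift_tscale (U : lmodType K) (f : V -> W -> U) a t : bilin f ->
  tlift f (tscale a t) = a *: tlift f t.
Proof.
move=> bf; rewrite tlift_pi // /fsum big_map scaler_sumr.
by apply: eq_bigr => p _; rewrite /= bilin_Zl.
Qed.

Lemma taddA : associative tadd.
Proof. by move=> t u v; apply: tensP => U f bf; rewrite !tlift_tadd // addrA. Qed.
Lemma taddC : commutative tadd.
Proof. by move=> t u; apply: tensP => U f bf; rewrite !tlift_tadd // addrC. Qed.
Lemma tadd0 : left_id tzero tadd.
Proof.
by move=> t; apply: tensP => U f bf; rewrite tlift_tadd // tlift_tzero // add0r.
Qed.
Lemma taddN : left_inverse tzero topp tadd.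
Proof.
move=> t; apply: tensP => U f bf.
by rewrite tlift_tadd // tlift_tzero // tlift_tscale // scaleN1r addNr.
Qed.

HB.instance Definition _ := GRing.isZmodule.Build tens taddA taddC tadd0 taddN.

Lemma tscaleA a b t : tscale a (tscale b t) = tscale (a * b) t.
Proof. by apply: tensP => U f bf; rewrite !tlift_tscale // scalerA. Qed.
Lemma tscale1 : left_id 1 tscale.
Proof. by move=> t; apply: tensP => U f bf; rewrite tlift_tscale // scale1r. Qed.
Lemma tscaleDr : right_distributive tscale +%R.
Proof.
move=> a t u; apply: tensP => U f bf.
by rewrite tlift_tscale // !tlift_tadd // !tlift_tscale // scalerDr.
Qed.
Lemma tscaleDl t : {morph tscale^~ t : a b / a + b}.
Proof.
move=> a b; apply: tensP => U f bf.
by rewrite tlift_tadd // !tlift_tscale // scalerDl.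
Qed.

HB.instance Definition _ :=
  GRing.Zmodule_isLmodule.Build K tens tscaleA tscale1 tscaleDr tscaleDl.

End TensorDef.

Notation "v ⊗ w" := (pure v w) (at level 40, left associativity) : ring_scope.

Section TensorTheory.
Context (K : fieldType) (V W : lmodType K).
Implicit Types (t u : tens V W).

Lemma tliftD (U : lmodType K) (f : V -> W -> U) t u : bilin f ->
  tlift f (t + u) = tlift f t + tlift f u.
Proof. exact: tlift_tadd. Qed.

Lemma tliftZ (U : lmodType K) (f : V -> W -> U) a t : bilin f ->
  tlift f (a *: t) = a *: tlift f t.
Proof. exact: tlift_tscale. Qed.

Lemma tlift0 (U : lmodType K) (f : V -> W -> U) : bilin f ->
  tlift f (0 : tens V W) = 0.
Proof. exact: tlift_tzero. Qed.

Lemma tlift_pure (U : lmodType K) (f : V -> W -> U) v w : bilin f ->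
  tlift f (v ⊗ w) = f v w.
Proof. by move=> bf; rewrite tlift_pi // /fsum big_seq1. Qed.

Lemma pure_bilin : bilin (@pure K V W).
Proof.
by apply: bilinI => *; apply: tensP => U f bf;
  rewrite ?(tliftD, tliftZ, tlift_pure) // ?(bilin_Dl, bilin_Dr, bilin_Zl, bilin_Zr).
Qed.

Lemma tens_ind (P : tens V W -> Prop) :
  P 0 -> (forall v w t, P t -> P (v ⊗ w + t)) -> forall t, P t.
Proof.
move=> P0 PD t; rewrite -[t]tseqK; elim: (tseq t) => [|[v w] s IH] //.
suff -> : mktens ((v, w) :: s) = v ⊗ w + mktens s.
  exact: PD.
apply: tensP => U f bf; rewrite tliftD // tlift_pure // !tlift_pi //.
by rewrite /fsum big_cons.
Qed.

Lemma eq_tlift (U : lmodType K) (f f' : V -> W -> U) :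
  f =2 f' -> tlift f =1 tlift f'.
Proof. by move=> ff' t; apply: eq_bigr => p _; apply: ff'. Qed.

Lemma tlift_fD (U : lmodType K) (f f' : V -> W -> U) t :
  tlift (fun v w => f v w + f' v w) t = tlift f t + tlift f' t.
Proof. exact: big_split. Qed.

Lemma tlift_fZ (U : lmodType K) (f : V -> W -> U) a t :
  tlift (fun v w => a *: f v w) t = a *: tlift f t.
Proof. by rewrite /tlift /fsum scaler_sumr. Qed.

Lemma tlift_id t : tlift (@pure K V W) t = t.
Proof.
elim/tens_ind: t => [|v w t IH]; first by rewrite tlift0 //; apply: pure_bilin.
by rewrite tliftD ?tlift_pure ?IH //; apply: pure_bilin.
Qed.

(* Two linear maps agreeing on pure tensors agree. *)
Lemma tens_ext (U : zmodType) (F F' : tens V W -> U) :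
  {morph F : t u / t + u} -> {morph F' : t u / t + u} ->
  (forall v w, F (v ⊗ w) = F' (v ⊗ w)) -> F =1 F'.
Proof.
move=> FD F'D FF' t; elim/tens_ind: t => [|v w t IH]; last first.
  by rewrite FD F'D IH FF'.
have z (G : tens V W -> U) : {morph G : t u / t + u} -> G 0 = 0.
  by move=> GD; apply: (addrI (G 0)); rewrite -GD !addr0.
by rewrite !z.
Qed.
End TensorTheory.

Lemma tlift_bilin (K : fieldType) (V W V' W' U : lmodType K)
    (f : V -> W -> V' -> W' -> U) :
  (forall v w, bilin (f v w)) -> (forall v' w', bilin (fun v w => f v w v' w')) ->
  forall u, bilin (fun v w => tlift (f v w) u).
Proof.
move=> b1 b2 u; apply: bilinI => *; rewrite -?tlift_fD -?tlift_fZ;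
  apply: eq_tlift => v' w'.
- exact: (bilin_Dl (b2 v' w')).
- exact: (bilin_Dr (b2 v' w')).
- exact: (bilin_Zl (b2 v' w')).
- exact: (bilin_Zr (b2 v' w')).
Qed.

Section TensorAlgebra.
Context (K : fieldType) (A B : algType K).

Definition tmul (t u : tens A B) : tens A B :=
  tlift (fun a b => tlift (fun a' b' => (a * a') ⊗ (b * b')) u) t.

Lemma tmul_inner a b : bilin (fun a' b' => (a * a') ⊗ (b * b') : tens A B).
Proof.
have pb := @pure_bilin K A B.
by apply: bilinI => *; rewrite ?(mulrDr, bilin_Dl pb, bilin_Dr pb) //
  -?scalerAr ?(bilin_Zl pb, bilin_Zr pb).
Qed.

Lemma tmul_outer (u : tens A B) :
  bilin (fun a b => tlift (fun a' b' => (a * a') ⊗ (b * b')) u : tens A B).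
Proof.
have pb := @pure_bilin K A B.
apply: (tlift_bilin tmul_inner) => a' b'.
by apply: bilinI => *; rewrite ?(mulrDl, bilin_Dl pb, bilin_Dr pb) //
  -?scalerAl ?(bilin_Zl pb, bilin_Zr pb).
Qed.

Lemma tmulDl : left_distributive tmul +%R.
Proof. by move=> t t' u; rewrite /tmul tliftD //; apply: tmul_outer. Qed.

Lemma tmulDr : right_distributive tmul +%R.
Proof.
move=> t u u'; rewrite /tmul -tlift_fD; apply: eq_tlift => a b.
by rewrite tliftD //; apply: tmul_inner.
Qed.

Lemma tmul_pure a b a' b' : tmul (a ⊗ b) (a' ⊗ b') = (a * a') ⊗ (b * b').
Proof. by rewrite /tmul !tlift_pure //; [apply: tmul_inner|apply: tmul_outer]. Qed.

Lemma tmulA : associative tmul.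
Proof.
move=> t u v; move: t; apply: tens_ext => [s t|s t|a b]; rewrite ?tmulDl //.
move: u; apply: tens_ext => [s t|s t|a' b']; rewrite ?(tmulDl, tmulDr) //.
move: v; apply: tens_ext => [s t|s t|a'' b'']; rewrite ?(tmulDl, tmulDr) //.
by rewrite !tmul_pure !mulrA.
Qed.

Lemma tmul1 : left_id (1 ⊗ 1) tmul.
Proof.
by apply: tens_ext => [s t|s t|a b]; rewrite ?tmulDr ?tmul_pure ?mul1r.
Qed.

Lemma tmulr1 : right_id (1 ⊗ 1) tmul.
Proof.
by apply: tens_ext => [s t|s t|a b]; rewrite ?tmulDl ?tmul_pure ?mulr1.
Qed.

HB.instance Definition _ := GRing.Zmodule_isPzRing.Build (tens A B)
  tmulA tmul1 tmulr1 tmulDl tmulDr.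

End TensorAlgebra.

HB.mixin Record isHopfAlgebra (K : fieldType) H of GRing.Algebra K H := {
  comul : H -> tens H H;
  counit : H -> K^o;
  antipode : H -> H;
  comul_linear : linear comul;
  comul_monoid : monoid_morphism comul;
  counit_linear : linear counit;
  counit_monoid : monoid_morphism counit;
  antipode_linear : linear antipode;
  coassoc : forall h,
    tlift (fun h1 h2 => tlift (fun h11 h12 => h11 ⊗ (h12 ⊗ h2)) (comul h1))
      (comul h)
    = tlift (fun h1 h2 => h1 ⊗ comul h2) (comul h);
  counitl : forall h, tlift (fun h1 h2 => counit h1 *: h2) (comul h) = h;
  counitr : forall h, tlift (fun h1 h2 => counit h2 *: h1) (comul h) = h;
  antipodel : forall h,
    tlift (fun h1 h2 => antipode h1 * h2) (comul h) = counit h *: 1;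
  antipoder : forall h,
    tlift (fun h1 h2 => h1 * antipode h2) (comul h) = counit h *: 1
}.

#[short(type="hopfAlgType")]
HB.structure Definition HopfAlgebra (K : fieldType) :=
  {H of GRing.Algebra K H & isHopfAlgebra K H}.

(* sweedler f h is the sum of the f h_1 h_2, in Sweedler notation. *)
Definition sweedler (K : fieldType) (H : hopfAlgType K) (U : lmodType K)
  (f : H -> H -> U) (h : H) : U := tlift f (comul h).

HB.mixin Record isModuleAlgebra (K : fieldType) (H : hopfAlgType K) R
    of GRing.Algebra K R := {
  hact : H -> R -> R;
  hact_bilin : bilin hact;
  hact1 : forall r, hact 1 r = r;
  hactM : forall h h' r, hact (h * h') r = hact h (hact h' r);
  hact_one : forall h, hact h 1 = counit h *: 1;
  hact_mul : forall h r r',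
    hact h (r * r') = sweedler (fun h1 h2 => hact h1 r * hact h2 r') h
}.

#[short(type="modAlgType")]
HB.structure Definition ModuleAlgebra (K : fieldType) (H : hopfAlgType K) :=
  {R of GRing.Algebra K R & isModuleAlgebra K H R}.

Section SweedlerTheory.
Context (K : fieldType) (H : hopfAlgType K).

Lemma tlift_morph (V W U U' : lmodType K) (G : U -> U') (f : V -> W -> U) t :
  linear G -> G (tlift f t) = tlift (fun v w => G (f v w)) t.
Proof.
move=> lG; rewrite /tlift /fsum; apply: big_morph.
  exact: linear_D.
exact: linear_0.
Qed.

Lemma sweedlerP (U : lmodType K) (f : H -> H -> U) : bilin f ->
  linear (sweedler f).
Proof.
by move=> bf a h h'; rewrite /sweedler comul_linear tliftD // tliftZ.
Qed.

Lemma sweedlerD (U : lmodType K) (f : H -> H -> U) h h' : bilin f ->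
  sweedler f (h + h') = sweedler f h + sweedler f h'.
Proof. by move=> bf; apply: (linear_D (sweedlerP bf)). Qed.

Lemma sweedlerZ (U : lmodType K) (f : H -> H -> U) a h : bilin f ->
  sweedler f (a *: h) = a *: sweedler f h.
Proof. by move=> bf; apply: (linear_Z (sweedlerP bf)). Qed.

Lemma sweedler_coassoc (U : lmodType K) (F : H -> H -> H -> U) h :
    (forall a, bilin (F a)) -> (forall b c, linear (fun a => F a b c)) ->
  sweedler (fun h1 h2 => sweedler (fun h11 h12 => F h11 h12 h2) h1) h
  = sweedler (fun h1 h2 => sweedler (F h1) h2) h.
Proof.
move=> bF lF.
pose G (a : H) (t : tens H H) := tlift (F a) t.
have bG : bilin G.
  split => [t|a] c x y; last by rewrite /G tliftD ?tliftZ.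
  by rewrite /= /G -tlift_fZ -tlift_fD; apply: eq_tlift => b b'; apply: lF.
have lG : linear (tlift G) by move=> c x y; rewrite tliftD ?tliftZ.
have := congr1 (tlift G) (coassoc h); rewrite !(tlift_morph _ _ lG) => E.
transitivity (sweedler (fun h1 h2 => tlift G (h1 ⊗ comul h2)) h); last first.
  by apply: eq_tlift => a b; rewrite tlift_pure.
rewrite /sweedler -E; apply: eq_tlift => a c.
rewrite (tlift_morph _ _ lG); apply: eq_tlift => b b'.
by rewrite tlift_pure // /G tlift_pure.
Qed.

Lemma sweedlerM (U : lmodType K) (f : H -> H -> U) h h' : bilin f ->
  sweedler f (h * h') =
  sweedler (fun h1 h2 => sweedler (fun k1 k2 => f (h1 * k1) (h2 * k2)) h') h.
Proof.
move=> bf; rewrite /sweedler comul_monoid.2.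
have lf : linear (tlift f) by move=> c x y; rewrite tliftD ?tliftZ.
rewrite [_ * _]/(tmul _ _) /tmul (tlift_morph _ _ lf); apply: eq_tlift => a b.
rewrite (tlift_morph _ _ lf); apply: eq_tlift => a' b'.
by rewrite tlift_pure.
Qed.

Lemma sweedler1 (U : lmodType K) (f : H -> H -> U) : bilin f ->
  sweedler f 1 = f 1 1.
Proof. by move=> bf; rewrite /sweedler comul_monoid.1 tlift_pure. Qed.

Lemma tlift_exchange (V W V' W' U : lmodType K) (f : V -> W -> V' -> W' -> U) t u :
  tlift (fun v w => tlift (f v w) u) t =
  tlift (fun v' w' => tlift (fun v w => f v w v' w') t) u.
Proof. exact: exchange_big. Qed.

End SweedlerTheory.

(* R # H is carried by R ⊗ H; the elementary tensor r ⊗ h is the usual r # h. *)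
Section Smash.
Context (K : fieldType) (H : hopfAlgType K) (R : modAlgType H).

Definition smash : Type := tens R H.
HB.instance Definition _ := GRing.Lmodule.on smash.

Definition smash_mul (t u : smash) : smash :=
  tlift (fun r h =>
    tlift (fun r' h' =>
      sweedler (fun h1 h2 => (r * hact h1 r') ⊗ (h2 * h') : tens R H) h) u) t.

Let pb := @pure_bilin K R H.
Let ab := @hact_bilin K H R.

Lemma smash_bilin1 r r' h' :
  bilin (fun h1 h2 => (r * hact h1 r') ⊗ (h2 * h') : tens R H).
Proof.
apply: bilinI => *; rewrite ?(mulrDl, bilin_Dl ab, mulrDr) ?(bilin_Dl pb) ?(bilin_Dr pb) //
  -?scalerAl ?(bilin_Zl ab) -?scalerAr ?(bilin_Zl pb, bilin_Zr pb) //.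
Qed.

Lemma smash_bilin2 r h : bilin (fun r' h' =>
  sweedler (fun h1 h2 => (r * hact h1 r') ⊗ (h2 * h') : tens R H) h).
Proof.
apply: bilinI => *; rewrite -?tlift_fD -?tlift_fZ; apply: eq_tlift => h1 h2.
- by rewrite (bilin_Dr ab) mulrDr (bilin_Dl pb).
- by rewrite mulrDr (bilin_Dr pb).
- by rewrite (bilin_Zr ab) -scalerAr (bilin_Zl pb).
- by rewrite -scalerAr (bilin_Zr pb).
Qed.

Lemma smash_bilin3 r' h' : bilin (fun r h =>
  sweedler (fun h1 h2 => (r * hact h1 r') ⊗ (h2 * h') : tens R H) h).
Proof.
have b1 r := smash_bilin1 r r' h'.
apply: bilinI => *; rewrite ?sweedlerD ?sweedlerZ //.
- by rewrite -tlift_fD; apply: eq_tlift => h1 h2; rewrite mulrDl (bilin_Dl pb).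
- by rewrite -tlift_fZ; apply: eq_tlift => h1 h2; rewrite -scalerAl (bilin_Zl pb).
Qed.

Lemma smash_bilin4 u : bilin (fun r h =>
    tlift (fun r' h' =>
      sweedler (fun h1 h2 => (r * hact h1 r') ⊗ (h2 * h') : tens R H) h) u).
Proof. by apply: tlift_bilin => *; [apply: smash_bilin2|apply: smash_bilin3]. Qed.

Lemma smash_mulE r h r' h' :
  smash_mul (r ⊗ h) (r' ⊗ h') =
  sweedler (fun h1 h2 => (r * hact h1 r') ⊗ (h2 * h')) h.
Proof.
rewrite /smash_mul tlift_pure ?tlift_pure //; first exact: smash_bilin2.
exact: smash_bilin4.
Qed.

Lemma smash_mulPl u : linear (smash_mul^~ u).
Proof. by move=> a t t'; rewrite /smash_mul /= tliftD ?tliftZ //; apply: smash_bilin4. Qed.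

Lemma smash_mulPr t : linear (smash_mul t).
Proof.
move=> a u u'; rewrite /smash_mul -tlift_fZ -tlift_fD; apply: eq_tlift => r h.
by rewrite tliftD ?tliftZ //; apply: smash_bilin2.
Qed.

Lemma smash_mulDl : left_distributive smash_mul +%R.
Proof. by move=> t t' u; apply: (linear_D (smash_mulPl u)). Qed.

Lemma smash_mulDr : right_distributive smash_mul +%R.
Proof. by move=> t u u'; apply: (linear_D (smash_mulPr t)). Qed.

Lemma smash_mulA : associative smash_mul.
Proof.
move=> t u v; move: t; apply: tens_ext => [s t|s t|r h]; rewrite ?smash_mulDl //.
move: u; apply: tens_ext => [s t|s t|r' h'];
  rewrite ?(smash_mulDl, smash_mulDr) //.
move: v; apply: tens_ext => [s t|s t|r'' h''];
  rewrite ?(smash_mulDl, smash_mulDr) //.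
rewrite !smash_mulE.
rewrite /sweedler (tlift_morph _ _ (smash_mulPr _)).
rewrite [RHS](tlift_morph _ _ (smash_mulPl _)) /= -!/(sweedler _ _).
pose F (k1 k2 a b c : H) : tens R H :=
  ((r * hact a r') * hact (b * k1) r'') ⊗ (c * (k2 * h'')).
have bF k1 k2 a : bilin (F k1 k2 a).
  apply: bilinI => *; rewrite /F.
  - by rewrite mulrDl (bilin_Dl ab) mulrDr (bilin_Dl pb).
  - by rewrite mulrDl (bilin_Dr pb).
  - by rewrite -scalerAl (bilin_Zl ab) -scalerAr (bilin_Zl pb).
  - by rewrite -scalerAl (bilin_Zr pb).
have lF k1 k2 b c : linear (fun a => F k1 k2 a b c).
  move=> x a a'; rewrite /F (bilin_Dl ab) (bilin_Zl ab) mulrDr mulrDl.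
  by rewrite (bilin_Dl pb) -scalerAr -scalerAl (bilin_Zl pb).
transitivity (sweedler (fun k1 k2 => sweedler (fun h1 h2 =>
   sweedler (fun h11 h12 => F k1 k2 h11 h12 h2) h1) h) h').
  apply: eq_tlift => k1 k2; rewrite smash_mulE; apply: eq_tlift => h1 h2.
  pose G (x : R) : tens R H := (r * x) ⊗ (h2 * (k2 * h'')).
  have lG : linear G.
    move=> a x y; rewrite /G mulrDr -scalerAr.
    by rewrite (bilin_Dl pb) (bilin_Zl pb).
  rewrite -[LHS]/(G _) hact_mul /sweedler (tlift_morph _ _ lG).
  by apply: eq_tlift => a b; rewrite /G /F hactM [r * (_ * _)]mulrA.
transitivity (sweedler (fun k1 k2 => sweedler (fun h1 h2 =>
   sweedler (F k1 k2 h1) h2) h) h').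
  by apply: eq_tlift => k1 k2; apply: sweedler_coassoc.
rewrite /sweedler tlift_exchange; apply: eq_tlift => h1 h2.
rewrite tlift_exchange -!/(sweedler _ _).
rewrite smash_mulE sweedlerM; last exact: smash_bilin1.
by apply: eq_tlift => a b; apply: eq_tlift => a' b'; rewrite /F !mulrA.
Qed.

Lemma smash_mul1l : left_id (1 ⊗ 1) smash_mul.
Proof.
apply: tens_ext => [s t|s t|r h]; rewrite ?smash_mulDr //.
by rewrite smash_mulE sweedler1 ?hact1 ?mul1r //; apply: smash_bilin1.
Qed.

Lemma smash_mul1r : right_id (1 ⊗ 1) smash_mul.
Proof.
apply: tens_ext => [s t|s t|r h]; rewrite ?smash_mulDl //.
rewrite smash_mulE -[in RHS](counitl h).
have lG : linear (pure r : H -> tens R H).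
  by move=> a x y; rewrite (bilin_Dr pb) (bilin_Zr pb).
rewrite (tlift_morph _ _ lG); apply: eq_tlift => h1 h2.
by rewrite hact_one mulr1 -scalerAr mulr1 (bilin_Zl pb) (bilin_Zr pb).
Qed.

HB.instance Definition _ := GRing.Zmodule_isPzRing.Build smash
  smash_mulA smash_mul1l smash_mul1r smash_mulDl smash_mulDr.

End Smash.

(* Ideals are taken relatively to a subset S of a ring A; when S is a subring,
   they are the ideals of the ring S. *)
Section Ideals.
Context (A : pzRingType).
Implicit Types (S I L : set A).
Local Open Scope classical_set_scope.

Definition left_ideal S L : Prop :=
  [/\ L `<=` S, L 0, forall a b, L a -> L b -> L (a - b)
    & forall s a, S s -> L a -> L (s * a)].

Definition two_sided_ideal S I : Prop :=
  left_ideal S I /\ forall s a, S s -> I a -> I (a * s).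

(* I ^ n is additively generated by the products of n elements of I. *)
Definition nilpotent_ideal I : Prop :=
  exists n, forall a : 'I_n -> A, (forall i, I (a i)) -> \prod_(i < n) a i = 0.

Definition semiprime S : Prop :=
  forall I, two_sided_ideal S I -> nilpotent_ideal I -> I = [set 0].

End Ideals.

(* R^<h> *)
Definition hact_ker (K : fieldType) (H : hopfAlgType K) (R : modAlgType H)
  (h : H) : set R := [set r | hact h r = 0]%classic.
Arguments hact_ker {K H} R h.

Section QuantumLinearSpace.
Context (K : fieldType) (gT : finGroupType) (theta : nat).
Context (g : 'I_theta -> gT) (chi : 'I_theta -> gT -> K) (m : 'I_theta -> nat).

Definition is_character (f : gT -> K) : Prop :=
  f 1%g = 1 /\ forall a b, f (a * b)%g = f a * f b.

Record qls_datum : Prop := QlsDatum {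
  qls_abelian : abelian [set: gT];
  qls_character : forall i, is_character (chi i);
  qls_order : forall i, (m i).-primitive_root (chi i (g i));
  qls_order_ge2 : forall i, (2 <= m i)%N;
  qls_braiding : forall i j, i != j -> chi i (g j) * chi j (g i) = 1
}.

Record qls_relations (A : algType K) (u : gT -> A) (x : 'I_theta -> A) : Prop :=
  QlsRelations {
  qls_u1 : u 1%g = 1;
  qls_uM : forall a b, u (a * b)%g = u a * u b;
  qls_ux : forall a i, u a * x i = chi i a *: (x i * u a);
  qls_x_nil : forall i, x i ^+ m i = 0;
  qls_xx : forall i j, i != j -> x i * x j = chi j (g i) *: (x j * x i)
}.

Definition grouplike (B : hopfAlgType K) (b : B) : Prop :=
  comul b = b ⊗ b /\ counit b = 1.

Definition skew_primitive (B : hopfAlgType K) (c d b : B) : Prop :=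
  comul b = c ⊗ b + b ⊗ d.

(* B is the Hopf algebra B(G, g, chi), with u : G -> B the inclusion of the
   grouplikes and x the skew-primitive generators.  As an algebra, B is
   presented by the generators u a, x i and the relations qls_relations: this
   is the universal property expressed by qls_exist and qls_unique. *)
Record is_qls_bosonization (B : hopfAlgType K)
    (u : gT -> B) (x : 'I_theta -> B) : Prop := IsQlsBosonization {
  qls_rel : qls_relations u x;
  qls_exist : forall (A : algType K) (u' : gT -> A) (x' : 'I_theta -> A),
    qls_relations u' x' ->
    exists f : {lrmorphism B -> A}, f \o u =1 u' /\ f \o x =1 x';
  qls_unique : forall (A : algType K) (f f' : {lrmorphism B -> A}),
    f \o u =1 f' \o u -> f \o x =1 f' \o x -> f =1 f';
  qls_grouplike : forall a, grouplike (u a);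
  qls_skew_primitive : forall i, skew_primitive (u (g i)) 1 (x i)
}.

End QuantumLinearSpace.

(* Main.v *)
Require Import Defs.
From HB Require Import structures.
From mathcomp Require Import all_boot all_order all_algebra all_fingroup.
From mathcomp Require Import boolp classical_sets.
From mathcomp Require Import ring cyclic separable cyclotomic.

Set Implicit Arguments.
Unset Strict Implicit.
Unset Printing Implicit Defensive.

Import GRing.Theory.
Local Open Scope classical_set_scope.
Local Open Scope ring_scope.

(* T = R # B is spanned by the r x^a h with h in G and x^a a monomial in the
   x_i; t denotes the top monomial, prod_i x_i^(m_i - 1), and R_k the common
   kernel in R of the x_i with i >= k (indices start at 0), so that R_0 is the
   ring of condition (1).  Since x_i t = 0, one has t r t = t(r) t in T.

   If T is semiprime, all the conditions hold for every ordering.  Let V be a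
   subset of R that is stable under G and the x_i, and let v0 be an element of
   V such that v0 t(R V) = 0.  Then a = v0 t satisfies a T a = 0, hence v0 = 0.
   For (2) and (3), V is the largest left ideal of R_(k+1) killed by x_k; for
   (1), v0 is a maximal nonzero product of elements of the sum of the
   G-translates of a nilpotent ideal of R_0.

   Conversely, one shows by induction on k that t_k = prod_(i < k) x_i^(m_i - 1)
   kills no nonzero left ideal of R_k.  Let V be the largest left ideal of
   R_(k+1) killed by x^(m-1), with x = x_k and m = m_k, and suppose that
   N = V^<x> is nonzero.  Choose e maximal with x^e(R_(k+1)) N <> 0; one has
   e >= 1 by the hypothesis on x_k, and e < m - 1 as N is in V.  Applying
   x^(e+1) to x^(e-1)(r) n r' n' only leaves the term with coefficient the
   q-integer [e+1], which is nonzero as e + 1 < m, so that x^e(R_(k+1)) N has square zero.  Its image by t_k is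
   then a nilpotent left ideal of the semiprime ring R_0, which contradicts the
   induction hypothesis.

   Finally let J be a nonzero ideal of T with J^2 = 0.  Multiplying an element
   of J by a suitable idempotent of kG (up to a scalar) and a suitable monomial
   gives an element r t E of J, with r nonzero and E = sum_h lam(h^-1) h for a
   character lam.  The set L of all such r (lam being fixed) is a left ideal,
   and J^2 = 0 reads r sum_h h(t(r')) = 0 for r, r' in L.  Thus S = t(L) is a
   left ideal of R_0 that annihilates its G-invariants on the left.  As S is
   graded by the dual of G, the pigeonhole principle applied to the degrees of
   the partial products shows that S is nilpotent, hence zero, so L = 0. *)

(** * Semiprime rings and nilpotent ideals *)

Section Semiprime.
Context (A : pzRingType).
Implicit Types (S I L P : set A) (l : seq A).

Definition subring_set S : Prop :=
  [/\ S 1, forall a b, S a -> S b -> S (a - b)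
    & forall a b, S a -> S b -> S (a * b)].

Definition sums P : set A :=
  [set a | exists2 s : seq A, {in s, forall b, P b} & a = \sum_(b <- s) b].

Lemma sumsD P a b : sums P a -> sums P b -> sums P (a + b).
Proof.
move=> [s sP ->] [s' s'P ->]; exists (s ++ s'); last by rewrite big_cat.
by move=> c; rewrite mem_cat => /orP[/sP|/s'P].
Qed.

Lemma sums1 P a : P a -> sums P a.
Proof. by move=> Pa; exists [:: a]; rewrite ?big_seq1 // => b /[!inE] /eqP->. Qed.

Lemma sums0 P : sums P 0.
Proof. by exists [::]; rewrite ?big_nil. Qed.

Lemma sums_ind P (Q : A -> Prop) : Q 0 -> (forall a b, Q a -> Q b -> Q (a + b)) ->
  (forall a, P a -> Q a) -> forall a, sums P a -> Q a.
Proof.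
move=> Q0 QD PQ _ [s sP ->]; elim: s sP => [|b s IH] sP; first by rewrite big_nil.
rewrite big_cons; apply: QD; first by apply/PQ/sP; rewrite mem_head.
by apply: IH => c cs; apply: sP; rewrite inE cs orbT.
Qed.

(** The two-sided ideal of [S] generated by [a] has square zero. *)
Lemma semiprime_elem S a : subring_set S -> semiprime S -> S a ->
  (forall s, S s -> a * s * a = 0) -> a = 0.
Proof.
move=> [S1 SB SM] spS Sa asa.
have S0 : S 0 by rewrite -(subrr 1); apply: SB.
have SN b : S b -> S (- b) by rewrite -sub0r; apply: SB.
have SD b c : S b -> S c -> S (b + c) by move=> Sb /SN; rewrite -{2}[c]opprK; apply: SB.
pose P := [set b | exists s s', [/\ S s, S s' & b = s * a * s']].
have PN b : P b -> P (- b).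
  by move=> [s [s' [Ss Ss' ->]]]; exists (- s), s'; rewrite !mulNr; split=> //; apply: SN.
have idP : two_sided_ideal S (sums P).
  split; [split|].
  - apply: sums_ind => //.
    by move=> _ [s [s' [Ss Ss' ->]]]; apply: (SM) => //; apply: SM.
  - exact: sums0.
  - move=> b c sb sc; apply: sumsD => //; move: sc; apply: (@sums_ind _ (fun c => sums P (- c))).
    + by rewrite oppr0; apply: sums0.
    + by move=> d e sd se; rewrite opprD; apply: sumsD.
    + by move=> d /PN /sums1.
  - move=> s b Ss; apply: (@sums_ind _ (fun b => sums P (s * b))).
    + by rewrite mulr0; apply: sums0.
    + by move=> d e sd se; rewrite mulrDr; apply: sumsD.
    + move=> _ [s1 [s2 [Ss1 Ss2 ->]]]; apply: sums1; exists (s * s1), s2.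
      by rewrite !mulrA; split=> //; apply: SM.
  - move=> s b Ss; apply: (@sums_ind _ (fun b => sums P (b * s))).
    + by rewrite mul0r; apply: sums0.
    + by move=> d e sd se; rewrite mulrDl; apply: sumsD.
    + move=> _ [s1 [s2 [Ss1 Ss2 ->]]]; apply: sums1; exists s1, (s2 * s).
      by rewrite !mulrA; split=> //; apply: SM.
have PP b c : sums P b -> sums P c -> b * c = 0.
  move=> sb sc; move: b sb; apply: sums_ind; first by rewrite mul0r.
    by move=> d e; rewrite mulrDl => -> ->; rewrite addr0.
  move=> _ [s1 [s2 [Ss1 Ss2 ->]]]; move: c sc; apply: sums_ind; first by rewrite mulr0.
    by move=> d e; rewrite mulrDr => -> ->; rewrite addr0.
  move=> _ [s3 [s4 [Ss3 Ss4 ->]]].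
  transitivity (s1 * (a * (s2 * s3) * a) * s4); first by rewrite !mulrA.
  by rewrite asa ?mulr0 ?mul0r //; apply: SM.
have I0 : sums P = [set 0].
  apply: spS => //; exists 2%N => f fP.
  by rewrite big_ord_recl big_ord_recl big_ord0 mulr1 PP.
suff : sums P a by rewrite I0.
by apply: sums1; exists 1, 1; rewrite mul1r mulr1.
Qed.

Lemma nilpotent_idealP I : nilpotent_ideal I <->
  exists n, forall l, size l = n -> {in l, forall a, I a} -> \prod_(a <- l) a = 0.
Proof.
split=> -[n nI]; exists n.
  move=> l sl lI; rewrite (big_nth 0) sl big_mkord.
  by apply: nI => i; apply/lI/mem_nth; rewrite sl.
move=> f fI; have := nI [seq f i | i <- enum 'I_n]; rewrite size_map size_enum_ord.
rewrite big_map enumT; apply=> // a /mapP[i _ ->]; exact: fI.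
Qed.

Lemma prod_nil_ge I n l :
  (forall l, size l = n -> {in l, forall a, I a} -> \prod_(a <- l) a = 0) ->
  (n <= size l)%N -> {in l, forall a, I a} -> \prod_(a <- l) a = 0.
Proof.
move=> nI nl lI; rewrite -(cat_take_drop n l) big_cat /= nI ?mul0r //.
  by rewrite size_takel.
by move=> a /mem_take /lI.
Qed.

(** The nilpotency index of [I] is at least 2, because exponents 0 and 1 would force [y = 0]; it is
    written [n.+2], and [l] is a nonzero product just below it. *)
Lemma nilpotent_top I y : nilpotent_ideal I -> I y -> y <> 0 ->
  exists n l, [/\ size l = n.+1, {in l, forall a, I a}, \prod_(a <- l) a <> 0
    & forall l', (n.+2 <= size l')%N -> {in l', forall a, I a} -> \prod_(a <- l') a = 0].
Proof.
move=> /nilpotent_idealP[n0 nI0] Iy y0.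
pose Q n := `[< forall l, size l = n -> {in l, forall a, I a} -> \prod_(a <- l) a = 0 >].
have exQ : exists n, Q n by exists n0; apply/asboolP.
case: (ex_minnP exQ) => [[|[|n]]] /asboolP nI min.
- by have := nI [::] erefl; rewrite big_nil => e; case: y0; rewrite -[y]mulr1 e ?mulr0.
- by case: y0; rewrite -(nI [:: y]) ?big_seq1 // => b /[!inE] /eqP->.
have /asboolP : ~~ Q n.+1 by apply/negP => /min; rewrite ltnn.
move=> /existsNP[l] /not_implyP[sl] /not_implyP[lI l0].
by exists n, l; split=> // l' sl' l'I; apply: prod_nil_ge nI sl' l'I.
Qed.

(** A nonzero product of maximal length, placed on both sides of some [s] in [S], gives 0: [s] is
    absorbed by the factor after it, and the concatenation is too long. *)
Lemma semiprime_nil S L a : subring_set S -> semiprime S -> L `<=` S ->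
  (forall s b, S s -> L b -> L (s * b)) -> nilpotent_ideal L -> L a -> a = 0.
Proof.
move=> subS spS LS SL nL La; apply: contrapT => a0.
have [n [l [sl lL l0 nl]]] := nilpotent_top nL La a0.
apply: l0; apply: (semiprime_elem subS spS).
  have [S1 SB SM] := subS.
  have {}lS : {in l, forall b, S b} by move=> b /lL /LS.
  elim: {sl lL} l lS => [|b l IH] lS; first by rewrite big_nil.
  rewrite big_cons; apply: SM; first by apply: lS; rewrite mem_head.
  by apply: IH => c cl; apply: lS; rewrite inE cl orbT.
move=> s Ss; case: l sl lL => [//|b l] sl lL.
have -> : (\prod_(a <- b :: l) a) * s * (\prod_(a <- b :: l) a) =
    \prod_(a <- (b :: l) ++ (s * b) :: l) a.
  by rewrite big_cat /= !big_cons !mulrA.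
apply: nl; first by rewrite size_cat sl /= addnS !ltnS leq_addr.
move=> c.
rewrite mem_cat => /orP[/lL//|]; rewrite inE => /orP[/eqP->|cl].
  by apply: SL => //; apply: lL; rewrite mem_head.
by apply: lL; rewrite inE cl orbT.
Qed.

(** By induction on [s]: modulo [F i], products of sums over [i :: s] are products of sums over [s],
    so [m] factors give an element of [F i], and [n] such blocks give 0. *)
Lemma nilpotent_ideal_sum (T : Type) (F : T -> set A) S (s : seq T) :
  subring_set S -> (forall i, two_sided_ideal S (F i)) ->
  (forall i, nilpotent_ideal (F i)) ->
  nilpotent_ideal [set a | exists2 f, (forall i, F i (f i)) & a = \sum_(i <- s) f i].
Proof.
move=> subS idF nF; have [S1 SB SM] := subS.
have S0 : S 0 by rewrite -(subrr 1); apply: SB.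
have SD b c : S b -> S c -> S (b + c).
  by move=> Sb Sc; rewrite -[c]opprK; apply: (SB) => //; rewrite -sub0r; apply: SB.
pose J s : set A := [set a | exists2 f, (forall i, F i (f i)) & a = \sum_(i <- s) f i].
rewrite -/(J s); elim: s => [|i s /nilpotent_idealP[m nJ]].
  exists 1%N => f fI; have [g _] := fI ord0.
  by rewrite big_ord_recl big_ord0 big_nil => ->; rewrite mul0r.
have [[FiS Fi0 FiB FiM] FiMr] := idF i.
have FiD b c : F i b -> F i c -> F i (b + c).
  by move=> Fb Fc; rewrite -[c]opprK; apply: (FiB) => //; rewrite -sub0r; apply: FiB.
have JS : J s `<=` S.
  move=> _ [f fF ->]; elim: (s) => [|j s' IH]; first by rewrite big_nil.
  by rewrite big_cons; apply: SD => //; have [[+ _ _ _] _] := idF j; apply.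
have [n nI] := (nilpotent_idealP _).1 (nF i).
apply/nilpotent_idealP; exists (n * m)%N.
have block l : {in l, forall a, J (i :: s) a} -> exists l' : seq A,
    [/\ size l' = size l, {in l', forall a, J s a}
      & F i (\prod_(a <- l) a - \prod_(a <- l') a)].
  elim: l => [|a l IH] lK; first by exists [::]; rewrite !big_nil subrr.
  have [|l' [sl' l'J Fl]] := IH; first by move=> b bl; apply: lK; rewrite inE bl orbT.
  have [|f fF ->] := lK a; first by rewrite mem_head.
  exists (\sum_(j <- s) f j :: l'); split=> /=; first by rewrite sl'.
    move=> b; rewrite inE => /orP[/eqP->|/l'J//]; by exists f.
  rewrite !big_cons; set c := \sum_(j <- s) _.
  have Jc : J s c by exists f.
  set p := \prod_(_ <- l) _ in Fl *; set p' := \prod_(_ <- l') _ in Fl *.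
  have -> : (f i + c) * p - c * p' = c * (p - p') + f i * (p - p') + f i * p'.
    by rewrite mulrDl !mulrBr -[RHS]addrA subrK [RHS]addrC addrA.
  have Sp' : S p'.
    rewrite /p'; elim: {sl' Fl p'} l' l'J => [|d l' IH'] l'J; first by rewrite big_nil.
    rewrite big_cons; apply: SM; first by apply/JS/l'J; rewrite mem_head.
    by apply: IH' => e el; apply: l'J; rewrite inE el orbT.
  have ? : S (f i) by apply: FiS.
  by apply: (FiD); [apply: (FiD); apply: (FiM) => //; apply: JS|apply: FiMr].
have split l k : size l = (k * m)%N -> {in l, forall a, J (i :: s) a} ->
    exists l' : seq A, [/\ size l' = k, {in l', forall a, F i a}
                         & \prod_(a <- l) a = \prod_(a <- l') a].
  elim: k l => [|k IH] l sl lK.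
    by exists [::]; split=> //; rewrite (size0nil sl).
  have [||l1 [sl1 l1F e1]] := IH (drop m l).
  - by rewrite size_drop sl mulSn addKn.
  - by move=> a /mem_drop /lK.
  have [|l2 [sl2 l2J e2]] := block (take m l); first by move=> a /mem_take /lK.
  rewrite (nJ l2) // ?subr0 in e2; last by rewrite sl2 size_takel // sl mulSn leq_addr.
  exists (\prod_(a <- take m l) a :: l1); split; first by rewrite /= sl1.
    by move=> a; rewrite inE => /orP[/eqP->|/l1F].
  by rewrite -{1}(cat_take_drop m l) big_cat big_cons /= e1.
move=> l sl /(split _ _ sl)[l' [sl' l'F ->]]; exact: nI.
Qed.

End Semiprime.

(** * The generators of the bosonization *)

Section GeneratedSubalgebra.
Context (K : fieldType) (A : algType K) (T : Type) (e : T -> A).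

Definition gen_closed (P : A -> Prop) : Prop :=
  [/\ P 1, forall a b c, P b -> P c -> P (a *: b + c)
    & forall b i, P b -> P (b * e i)].

Definition generated : {pred A} := fun b => `[< forall P, gen_closed P -> P b >].

Lemma generatedP b : b \in generated <-> forall P, gen_closed P -> P b.
Proof. by split=> [/asboolP|gb] //; apply/asboolP. Qed.

Lemma generated_closed : gen_closed (fun b => b \in generated).
Proof.
split=> [|a b c /generatedP gb /generatedP gc|b i /generatedP gb];
  apply/generatedP => P cP; have [P1 PD PM] := cP => //.
  by apply: PD; [apply: gb|apply: gc].
by apply: PM; apply: gb.
Qed.

Lemma generated_subalg : GRing.subalg_closed generated.
Proof.
have [g1 gD gM] := generated_closed; split=> [//|a b c|b c gb /generatedP gc]; first exact: gD.
apply: (gc (fun c => b * c \in generated)); split=> [|a d d'|d i]; first by rewrite mulr1.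
  by rewrite mulrDr -scalerAr; apply: gD.
by rewrite mulrA; apply: gM.
Qed.

HB.instance Definition _ := GRing.isSubalgClosed.Build K A generated generated_subalg.

Definition gen_sub : Type := {b : A | b \in generated}.
HB.instance Definition _ := SubType.copy gen_sub {b : A | b \in generated}.
HB.instance Definition _ := [Choice of gen_sub by <:].
HB.instance Definition _ := [SubChoice_isSubAlgebra of gen_sub by <:].

Lemma generator_generated i : e i \in generated.
Proof. by have [g1 _ gM] := generated_closed; rewrite -[e i]mul1r; apply: gM. Qed.

Definition gen_generator i : gen_sub := exist _ (e i) (generator_generated i).

Definition gen_val : gen_sub -> A := val.
HB.instance Definition _ := GRing.RMorphism.copy gen_val (val : gen_sub -> A).
HB.instance Definition _ := GRing.Linear.copy gen_val (val : gen_sub -> A).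

End GeneratedSubalgebra.

Section Generation.
Context (K : fieldType) (gT : finGroupType) (theta : nat).
Context (g : 'I_theta -> gT) (chi : 'I_theta -> gT -> K) (m : 'I_theta -> nat).
Context (B : hopfAlgType K) (u : gT -> B) (x : 'I_theta -> B).
Hypothesis isB : is_qls_bosonization g chi m u x.

Let e (s : gT + 'I_theta) : B := match s with inl a => u a | inr i => x i end.

(** Existence maps [B] to the subalgebra [C] generated by the [u a] and [x i]; followed by the
    inclusion, this map fixes the generators, so by uniqueness it is the identity. *)
Lemma qls_generated b : b \in generated e.
Proof.
have [relB exB unB _ _] := isB.
pose C := gen_sub e.
pose u' a : C := gen_generator e (inl a).
pose x' i : C := gen_generator e (inr i).
have relC : qls_relations g chi m u' x'.
  have [u1 uM ux xn xx] := relB.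
  split=> [|a a'|a i|i|i j ij]; apply: val_inj.
  - by rewrite rmorph1 /= u1.
  - by rewrite rmorphM /= uM.
  - by rewrite [RHS]linearZ !rmorphM /= ux.
  - by rewrite rmorphXn rmorph0 /= xn.
  - by rewrite [RHS]linearZ !rmorphM /= xx.
have [f [fu fx]] := exB C u' x' relC.
pose f' : {lrmorphism B -> B} := @gen_val _ _ _ e \o f.
have f'E : f' =1 idfun by apply: unB => [a|i] /=; [rewrite [f _]fu|rewrite [f _]fx].
by rewrite -[b]/(idfun b) -f'E; apply: valP.
Qed.

Lemma qls_ind (P : B -> Prop) : P 1 ->
  (forall a b c, P b -> P c -> P (a *: b + c)) ->
  (forall b a, P b -> P (b * u a)) -> (forall b i, P b -> P (b * x i)) ->
  forall b, P b.
Proof.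
move=> P1 PD Pu Px b; move/generatedP: (qls_generated b); apply; split=> // {}b [a|i].
  exact: Pu.
exact: Px.
Qed.

End Generation.

(** * A matrix model *)

Section Words.
Context (K : fieldType) (gT : finGroupType) (theta : nat).

Definition word_prod (A : algType K) (x : 'I_theta -> A) (s : seq 'I_theta) : A :=
  \prod_(i <- s) x i.

(** When [lam] is a character, this is [#|gT|] times the idempotent of the group algebra that
    projects to the [lam]-eigenspace. *)
Definition char_elt (A : algType K) (u : gT -> A) (lam : gT -> K) : A :=
  \sum_a lam (a^-1)%g *: u a.

End Words.

Section Model.
Context (K : fieldType) (gT : finGroupType) (theta : nat).
Context (g : 'I_theta -> gT) (chi : 'I_theta -> gT -> K) (m : 'I_theta -> nat).
Hypothesis datum : qls_datum g chi m.
Context (lam : gT -> K).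
Hypothesis lamP : is_character lam.

(* The model is the action on the monomials x^a twisted by lam.  One spare index
   makes the matrices an algType; dec sends it to a0, and the proofs only use
   that dec is a left inverse of code. *)
Let M := (\max_i m i)%N.
Let F := {ffun 'I_theta -> 'I_M.+1}.
Let a0 : F := [ffun => ord0].
Let N := #|F|.
Let dec (q : 'I_N.+1) : F := nth a0 (enum F) q.
Let code (a : F) : 'I_N.+1 := inord (enum_rank a).

Let codeK : cancel code dec.
Proof.
move=> a; rewrite /dec /code inordK; first by rewrite nth_enum_rank.
by apply: ltnW; rewrite ltnS ltn_ord.
Qed.

Let bump (i : 'I_theta) (a : F) : F := [ffun j => if j == i then inord (a j).+1 else a j].
Let room i (a : F) : bool := ((a i).+1 < m i)%N.

Let bumpE i (a : F) j : room i a -> bump i a j = (a j + (j == i))%N :> nat.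
Proof.
move=> ra; rewrite ffunE; case: eqVneq => [->|_]; last by rewrite addn0.
rewrite inordK ?addn1 // ltnS ltnW // (leq_trans ra) //.
exact: leq_bigmax.
Qed.

(** [coef i a] is the scalar picked up by x_i on its way past the x_j with [j < i] to its place in
    the ordered monomial x^a; [diag b a] is the eigenvalue of [b] on x^a. *)
Let coef (i : 'I_theta) (a : F) : K := \prod_(j < theta | (j < i)%N) chi j (g i) ^+ a j.
Let diag b (a : F) : K := lam b * \prod_j chi j b ^+ a j.

Definition model_u b : 'M[K]_N.+1 :=
  \matrix_(p, q) ((p == q)%:R * diag b (dec q)).
Definition model_x i : 'M[K]_N.+1 :=
  \matrix_(p, q) (if room i (dec q) then (p == code (bump i (dec q)))%:R * coef i (dec q) else 0).

Let mul_u (A : 'M[K]_N.+1) b p q : (A * model_u b) p q = A p q * diag b (dec q).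
Proof.
rewrite mxE (bigD1 q) //= big1 => [|k kq]; last by rewrite mxE (negPf kq) mul0r mulr0.
by rewrite !mxE eqxx mul1r addr0.
Qed.

Let mul_x (A : 'M[K]_N.+1) i p q : (A * model_x i) p q =
  if room i (dec q) then A p (code (bump i (dec q))) * coef i (dec q) else 0.
Proof.
rewrite mxE; case: ifP => [rq|/negP/negP nrq]; last first.
  by apply: big1 => k _; rewrite mxE (negPf nrq) mulr0.
rewrite (bigD1 (code (bump i (dec q)))) //= big1 => [|k kq]; last first.
  by rewrite mxE rq (negPf kq) mul0r mulr0.
by rewrite mxE rq eqxx mul1r addr0.
Qed.

Let chi_neq0 i b : chi i b != 0.
Proof.
have [c1 cM] := qls_character datum i; apply/eqP => c0.
by have /eqP := c1; rewrite -(mulgV b) cM c0 mul0r eq_sym oner_eq0.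
Qed.

Let prod_bump i (a : F) (f : 'I_theta -> K) (P : pred 'I_theta) : room i a ->
  \prod_(j | P j) f j ^+ bump i a j = (if P i then f i else 1) * \prod_(j | P j) f j ^+ a j.
Proof.
move=> ra; case: ifP => Pi; last first.
  rewrite mul1r; apply: eq_bigr => j Pj; rewrite bumpE //.
  by case: eqVneq Pj => [->|_ _]; rewrite ?Pi ?addn0.
rewrite (bigD1 i) // [in RHS](bigD1 i) //= mulrA bumpE // eqxx addn1 exprS.
congr (_ * _); apply: eq_bigr => j /andP[_ ji].
by rewrite bumpE // (negPf ji) addn0.
Qed.

Let room_bump i j (a : F) : i != j -> room j a -> room i (bump j a) = room i a.
Proof. by move=> ij rj; rewrite /room bumpE // (negPf ij) addn0. Qed.

Let bumpC i j (a : F) : i != j -> bump i (bump j a) = bump j (bump i a).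
Proof.
move=> ij; apply/ffunP => k; rewrite !ffunE.
by case: eqVneq => [->|//]; rewrite (negPf ij).
Qed.

Let model_pow i k (A : 'M[K]_N.+1) p q : (m i <= dec q i + k)%N -> (0 < k)%N ->
  (A * model_x i ^+ k) p q = 0.
Proof.
elim: k q => [//|[|k] IH] q mk _; rewrite ?expr1.
  by rewrite mul_x /room -addn1 ltnNge mk.
rewrite exprSr mulrA mul_x; case: ifP => // ri.
by rewrite IH ?mul0r // codeK bumpE // eqxx addn1 addSnnS.
Qed.

Lemma model_relations : qls_relations g chi m model_u model_x.
Proof.
have [lam1 lamM] := lamP.
split=> [|b c|b i|i|i j ij].
- apply/matrixP => p q; rewrite mxE /diag lam1 big1 => [|j _]; first by rewrite !mulr1 mxE.
  by have [-> _] := qls_character datum j; rewrite expr1n.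
- apply/matrixP => p q; rewrite mul_u !mxE -mulrA /diag lamM; congr (_ * _).
  rewrite mulrACA -big_split; congr (_ * _); apply: eq_bigr => j _.
  by have [_ ->] := qls_character datum j; rewrite exprMn.
- apply/matrixP => p q; rewrite mul_x [RHS]mxE mul_u.
  rewrite [model_x i p q]mxE; case: ifP => ri; last by rewrite mul0r mulr0.
  rewrite mxE /diag codeK prod_bump //=.
  case: eqVneq => [_|_]; last by rewrite !mul0r mulr0.
  by ring.
- apply/matrixP => p q; rewrite -[_ ^+ _]mul1r model_pow ?mxE ?leq_addl //.
  by apply: leq_trans (qls_order_ge2 datum i).
- apply/matrixP => p q; rewrite mul_x [RHS]mxE mul_x.
  rewrite ![model_x _ p _]mxE !codeK.
  case rj: (room j (dec q)); last first.
    case ri: (room i (dec q)); last by rewrite mulr0.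
    by rewrite room_bump // 1?eq_sym // rj mul0r mulr0.
  rewrite room_bump //; case ri: (room i (dec q)); last by rewrite mul0r mulr0.
  rewrite room_bump // 1?eq_sym // rj (bumpC _ ij).
  case: eqVneq => [_|_]; last by rewrite !mul0r mulr0.
  rewrite !mul1r /coef !prod_bump //.
  (* Bumping [j] changes [coef i] only if [j < i], and bumping [i] changes [coef j] only if [i < j];
     in the latter case the scalars cancel by the braiding relation. *)
  have : chi i (g j) * chi j (g i) = 1 by apply: (qls_braiding datum).
  case: (ltngtP i j) => [_|_|/ord_inj/eqP]; last by rewrite (negPf ij).
    by move=> e; ring: e.
  by move=> e; ring.
Qed.

Let model_word s (a b : F) :
  (forall i, a i + count_mem i s = b i)%N -> (forall i, b i < m i)%N ->
  word_prod model_x s (code b) (code a) != 0.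
Proof.
elim/last_ind: s a => [|s i IH] a ab bm.
  have -> : a = b by apply/ffunP => i; apply/val_inj; rewrite /= -ab addn0.
  by rewrite /word_prod big_nil mxE eqxx oner_neq0.
have ri : room i a.
  apply: leq_ltn_trans (bm i); rewrite -ab -cats1 count_cat /= eqxx addn0 addnA addn1.
  by rewrite ltnS leq_addr.
rewrite /word_prod -cats1 big_cat /= big_seq1 mul_x codeK ri mulf_neq0 //.
  apply: IH bm => j; rewrite bumpE // -ab -cats1 count_cat /= addn0 -addnA [(_ == j)]eq_sym.
  by congr (_ + _)%N; rewrite addnC.
by apply/prodf_neq0 => j _; apply: expf_neq0.
Qed.

(** The entry leads from the monomial 1 to the top monomial. On 1 every [a] acts by [lam a], so
    [char_elt] acts by [#|gT|], nonzero in characteristic 0; the word then contributes a product of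
    nonzero coefficients. *)
Lemma model_top_neq0 s : [pchar K] =i pred0 ->
  (forall i, count_mem i s = (m i).-1) ->
  exists p q, (word_prod model_x s * char_elt model_u lam) p q != 0.
Proof.
move=> char0 cs; pose b : F := [ffun i => inord (m i).-1].
have m_gt0 i : (0 < m i)%N by apply: leq_trans (qls_order_ge2 datum i).
have bE i : b i = (m i).-1 :> nat.
  rewrite ffunE inordK // ltnS (leq_trans (leq_pred _)) //; exact: leq_bigmax.
exists (code b), (code a0); rewrite /char_elt mulr_sumr summxE.
rewrite (eq_bigr (fun=> word_prod model_x s (code b) (code a0))) => [|a _].
  rewrite sumr_const -mulr_natr mulf_neq0 //.
    by apply: model_word => i; rewrite ?bE ?prednK // ffunE add0n cs.
  have /pcharf0P -> := char0; rewrite cardT -cardE.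
  by apply/eqP => /card0_eq /(_ 1%g); rewrite inE.
rewrite -scalerAr mxE mul_u /diag codeK big1 => [|j _]; last by rewrite ffunE expr0.
by rewrite mulr1 mulrCA -lamP.2 mulVg lamP.1 mulr1.
Qed.

End Model.

(** * Freeness of the top monomial *)

Section Freeness.
Context (K : fieldType) (gT : finGroupType) (theta : nat).
Context (g : 'I_theta -> gT) (chi : 'I_theta -> gT -> K) (m : 'I_theta -> nat).
Context (B : hopfAlgType K) (u : gT -> B) (x : 'I_theta -> B).

(** A nonzero matrix entry in the model is a linear form on [B] that does not vanish on the right
    factor; contracting with it recovers [v] up to a nonzero scalar. *)
Lemma pure_top_eq0 (lam : gT -> K) s (V : lmodType K) (v : V) :
  [pchar K] =i pred0 -> qls_datum g chi m -> is_qls_bosonization g chi m u x ->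
  is_character lam -> (forall i, count_mem i s = (m i).-1) ->
  v ⊗ (word_prod x s * char_elt u lam) = 0 -> v = 0.
Proof.
move=> char0 datum isB lamP cs.
have [f [fu fx]] := qls_exist isB (model_relations datum lamP).
have [p [q]] := model_top_neq0 datum lamP char0 cs.
set w := word_prod x s * _.
have <- : f w = word_prod (model_x g chi m) s * char_elt (model_u chi m lam) lam.
  rewrite rmorphM /word_prod /char_elt; congr (_ * _).
    by rewrite rmorph_prod; apply: eq_bigr => i _; rewrite -fx.
  by rewrite raddf_sum; apply: eq_bigr => a _ /=; rewrite linearZ -fu.
move=> fw v0; pose F (v : V) (b : B) := f b p q *: v.
have bF : bilin F.
  by apply: bilinI => *; rewrite /F ?linearD ?linearZ ?mxE /=;
    rewrite ?scalerDr ?scalerDl ?mxE ?scalerA // mulrC.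
have := congr1 (tlift F) v0; rewrite tlift0 // tlift_pure // => /eqP.
by rewrite scaler_eq0 (negPf fw) => /eqP.
Qed.

End Freeness.

(** * Eigenvectors of a finite abelian group *)
(** In characteristic 0 the polynomial X^n - 1 is separable, and [n] distinct roots of it include a
    primitive one. *)
Lemma closed_prim_root (K : closedFieldType) n : [pchar K] =i pred0 -> (0 < n)%N ->
  exists z : K, n.-primitive_root z.
Proof.
move=> char0 n0; have nK : n%:R != 0 :> K by rewrite ((pcharf0P _).1 char0) -lt0n.
have [r] := closed_field_poly_normal ('X^n - 1 : {poly K}).
rewrite (monicP (monicXnsubC 1 n0)) scale1r => rE.
have sz : size r = n by apply/succn_inj; rewrite -(size_prod_XsubC r id) -rE size_XnsubC.
have /hasP[z _ pz] : has n.-primitive_root r; last by exists z.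
apply: has_prim_root => //; last by rewrite sz.
  by apply/allP => z zr; rewrite /root_of_unity rE root_prod_XsubC.
by rewrite -separable_prod_XsubC -rE; apply: separable_Xn_sub_1.
Qed.

Section Eigen.
Context (K : closedFieldType) (gT : finGroupType).
Hypothesis char0 : [pchar K] =i pred0.
Hypothesis abG : abelian [set: gT]%SET.
Context (z : K).
Hypothesis zP : #|gT|.-primitive_root z.

(** [f] plays the part of a degree: it matters only modulo [#|gT|], and the degrees of factors add
    up in a product. *)
Definition homogeneous (V : lmodType K) (rho : gT -> V -> V) (v : V) : Prop :=
  exists f : gT -> nat, forall a, rho a v = z ^+ f a *: v.

Let gT_gt0 : (0 < #|gT|)%N.
Proof. by apply/card_gt0P; exists 1%g. Qed.

(** * Decomposition into common eigenvectors *)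

Section Decomposition.
Context (V : lmodType K) (rho : gT -> V -> V) (W : set V).
Hypotheses (rho_lin : forall a, linear (rho a)) (rho1 : forall v, rho 1%g v = v)
  (rhoM : forall a b v, rho (a * b)%g v = rho a (rho b v)).
Hypotheses (W0 : W 0) (WD : forall c v w, W v -> W w -> W (c *: v + w))
  (Wrho : forall a v, W v -> W (rho a v)).

Let N := #|gT|.
(** Averaging projector onto the [z ^+ i]-eigenspace of [rho b]; the sum runs over [#|gT|] powers
    whatever the order of [b]. *)
Let proj b i v : V := N%:R^-1 *: \sum_(j < N) z ^- (i * j) *: rho (b ^+ j)%g v.

Let projE b i v : rho b (proj b i v) = z ^+ i *: proj b i v.
Proof.
have z0 : z != 0.
  by apply/eqP => z0; have /eqP := prim_expr_order zP; rewrite z0 expr0n gtn_eqF // eq_sym oner_eq0.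
rewrite /proj (linear_Z (rho_lin b)) scalerA mulrC -scalerA; congr (_ *: _).
rewrite (big_morph (rho b) (linear_D (rho_lin b)) (linear_0 (rho_lin b))).
pose F j := z ^- (i * j) *: rho (b ^+ j)%g v.
transitivity (\sum_(j < N) z ^+ i *: F j.+1).
  apply: eq_bigr => j _; rewrite (linear_Z (rho_lin b)) -rhoM -expgS /F scalerA.
  rewrite mulnS exprD invfM mulVKf //.
  by rewrite expf_neq0.
rewrite -scaler_sumr; congr (_ *: _).
(* A cyclic shift of the sum, as [F N = F 0]. *)
have NE : N = N.-1.+1 by rewrite prednK.
rewrite NE big_ord_recr [RHS]big_ord_recl /= addrC; congr (_ + _).
rewrite /F -NE muln0 expr0 expg0 mulnC exprM (prim_expr_order zP) expr1n.
have -> : (b ^+ N = 1)%g by rewrite /N -cardsT expg_cardG // inE.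
by [].
Qed.

Let proj_sum b v : v = \sum_(i < N) proj b i v.
Proof.
have NK : N%:R != 0 :> K by rewrite ((pcharf0P _).1 char0) -lt0n.
rewrite -scaler_sumr exchange_big /=.
rewrite (bigD1 (Ordinal gT_gt0)) //= [X in _ + X]big1 => [|j j0].
  rewrite (eq_bigr (fun=> v)) => [|i _]; last by rewrite muln0 expr0 expg0 rho1 invr1 scale1r.
  by rewrite sumr_const card_ord addr0 -scaler_nat scalerA mulVf // scale1r.
rewrite -scaler_suml.
suff -> : \sum_(i < N) z ^- (i * j) = 0 by rewrite scale0r.
pose y := z ^- j.
have y1 : y != 1.
  rewrite invr_eq1 -(expr0 z) (eq_prim_root_expr zP) mod0n modn_small //.
have yN : y ^+ N = 1 by rewrite /y exprVn -exprM mulnC exprM (prim_expr_order zP) expr1n invr1.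
have := subrX1 y N; rewrite yN subrr => /esym/eqP.
rewrite mulf_eq0 subr_eq0 (negPf y1) /= => /eqP ys; rewrite -[RHS]ys.
by apply: eq_bigr => i _; rewrite /y exprVn -exprM mulnC.
Qed.

Let W_sum (I : Type) (s : seq I) (F : I -> V) : (forall i, W (F i)) -> W (\sum_(i <- s) F i).
Proof.
move=> WF; elim: s => [|i s IH]; rewrite ?big_nil // big_cons -[F i]scale1r; exact: WD.
Qed.

(** The group elements are treated one after the other: the projectors for a new element commute
    with the earlier ones and so keep their eigenvalues. *)
Lemma homogeneous_decomposition v : W v ->
  exists2 s : seq V, {in s, forall w, W w /\ homogeneous rho w} & v = \sum_(w <- s) w.
Proof.
suff dec (l : seq gT) : W v -> exists2 s : seq V,
    {in s, forall w, W w /\ exists f : gT -> nat, {in l, forall a, rho a w = z ^+ f a *: w}}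
    & v = \sum_(w <- s) w.
  move=> /(dec (enum gT))[s sP ->]; exists s => // w /sP[Ww [f fP]].
  by split=> //; exists f => a; apply: fP; rewrite mem_enum.
elim: l => [|b l IH] Wv.
  exists [:: v]; last by rewrite big_seq1.
  by move=> w; rewrite inE => /eqP ->; split=> //; exists (fun=> 0%N).
have [s sP ->] := IH Wv.
exists (flatten [seq [seq proj b (val i) w | i <- enum 'I_N] | w <- s]); last first.
  rewrite big_flatten big_map; apply: eq_bigr => w _.
  by rewrite big_map big_enum; apply: proj_sum.
move=> w' /flattenP[_ /mapP[w /sP[Ww [f fP]] ->] /mapP[i _ ->]]; split.
  rewrite -[proj _ _ _]addr0 /proj; apply: WD => //; apply: W_sum => j.
  by rewrite -[_ *: _]addr0; apply: WD => //; apply: Wrho.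
exists (fun a => if a == b then val i else f a) => a; rewrite inE.
case: eqVneq => [->|_ /= al]; first by rewrite projE.
rewrite /proj (linear_Z (rho_lin a)) [RHS]scalerA mulrC -scalerA; congr (_ *: _).
rewrite (big_morph (rho a) (linear_D (rho_lin a)) (linear_0 (rho_lin a))) scaler_sumr.
apply: eq_bigr => j _; rewrite (linear_Z (rho_lin a)) -rhoM.
have -> : (a * b ^+ j = b ^+ j * a)%g by apply: (centsP abG); rewrite inE.
by rewrite rhoM fP // (linear_Z (rho_lin _)) !scalerA mulrC.
Qed.

End Decomposition.

(** * Nilpotence from the annihilation of invariants *)

Section GradedNilpotent.
Context (R : algType K) (rho : gT -> R -> R) (S : set R).
Hypotheses (rho_lin : forall a, linear (rho a)) (rho1 : forall v, rho 1%g v = v)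
  (rhoM : forall a b v, rho (a * b)%g v = rho a (rho b v))
  (rho_mul : forall a r s, rho a (r * s) = rho a r * rho a s).
Hypotheses (S0 : S 0) (SD : forall c v w, S v -> S w -> S (c *: v + w))
  (Srho : forall a v, S v -> S (rho a v)) (SM : forall r s, S r -> S s -> S (r * s)).
Hypothesis S_fix : forall r s, S r -> S s -> (forall a, rho a s = s) -> r * s = 0.

Let FT := {ffun gT -> 'I_#|gT|}.

Let S_prod (r : R) l : {in r :: l, forall s, S s} -> S (\prod_(s <- r :: l) s).
Proof.
elim: l r => [|s l IH] r rS; first by rewrite big_seq1; apply: rS; rewrite inE.
rewrite big_cons; apply: SM; first by apply: rS; rewrite mem_head.
by apply: IH => t tl; apply: rS; rewrite inE tl orbT.
Qed.

Let hom_prod (l : seq R) (f : R -> gT -> nat) a :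
  {in l, forall w a, rho a w = z ^+ f w a *: w} ->
  l != [::] ->
  rho a (\prod_(w <- l) w) = z ^+ (\sum_(w <- l) f w a) *: \prod_(w <- l) w.
Proof.
elim: l => [//|w l IH] lf _; case: l IH lf => [_|w' l IH] lf.
  by rewrite !big_seq1 lf // inE.
rewrite big_cons rho_mul IH // => [|t tl]; last by apply: lf; rewrite inE tl orbT.
by rewrite lf ?mem_head // -scalerAl -scalerAr scalerA -exprD [in RHS]big_cons big_cons.
Qed.

(** Two of the prefixes have the same degree modulo [#|gT|], so the segment between them is a
    [G]-invariant product, annihilated by the prefix on its left. *)
Let homogeneous_nil (l : seq R) : (#|FT| < size l)%N ->
  {in l, forall w, S w /\ homogeneous rho w} -> \prod_(w <- l) w = 0.
Proof.
move=> sl lP.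
pose f (w : R) : gT -> nat :=
  if pselect (homogeneous rho w) is left h then projT1 (cid h) else fun=> 0%N.
have fP : {in l, forall w a, rho a w = z ^+ f w a *: w}.
  by move=> w /lP[_ hw]; rewrite /f; case: pselect => // h; case: cid.
(* Only prefixes of length [i.+1] are compared: the empty product 1 need not lie in [S]. *)
pose D (i : 'I_#|FT|.+1) : FT := [ffun a =>
  Ordinal (ltn_pmod (\sum_(w <- take i.+1 l) f w a)%N gT_gt0)].
have /injectivePn[i0 [j0 ij0 Dij0]] : ~~ injectiveb D.
  by apply/negP => /injectiveP /leq_card; rewrite card_ord ltnn.
have [i [j [ij Dij]]] : exists i j : 'I_#|FT|.+1, (i < j)%N /\ D i = D j.
  case: (ltngtP i0 j0) => [ij|ij|/val_inj ij]; first by exists i0, j0.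
    by exists j0, i0.
  by rewrite ij eqxx in ij0.
pose l1 := take i.+1 l; pose l2 := take (j - i) (drop i.+1 l).
have jE : take j.+1 l = l1 ++ l2 by rewrite -takeD addSn subnKC // ltnW.
have jl : (j < size l)%N by apply: leq_trans sl; rewrite ltnS -ltnS.
have l1n : l1 != [::] by rewrite -size_eq0 size_takel // (leq_trans ij) // ltnW.
have l2n : l2 != [::].
  by rewrite -size_eq0 size_takel ?subn_eq0 -?ltnNge // size_drop -(subSS i j) leq_sub2r.
have S_l (l' : seq R) : l' != [::] -> {subset l' <= l} -> S (\prod_(w <- l') w).
  case: l' => // w l' _ sub; apply: S_prod => s /sub /lP[]//.
have sub2 : {subset l2 <= l} by move=> w /mem_take /mem_drop.
rewrite -(cat_take_drop j.+1 l) jE big_cat big_cat /=.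
rewrite [X in X * _](_ : _ = 0) ?mul0r //; apply: S_fix.
- by apply: S_l => // w /mem_take.
- exact: S_l.
move=> a; rewrite (hom_prod (f := f)) // => [|w /sub2 /fP//].
have /(congr1 (fun d : FT => val (d a))) := Dij; rewrite !ffunE /= jE big_cat /=.
set c1 := (\sum_(w <- l1) _)%N; set c2 := (\sum_(w <- l2) _)%N => /esym/eqP.
rewrite -[in X in _ == X]/c1 -[X in _ == X %[mod _]]addn0 eqn_modDl mod0n => /eqP c20.
by rewrite -(prim_expr_mod zP) c20 scale1r.
Qed.

Lemma graded_nilpotent : nilpotent_ideal S.
Proof.
apply/nilpotent_idealP; exists #|FT|.+1.
(* [l1] collects homogeneous factors; those of [l2] are expanded one at a time. *)
suff gen (l2 l1 : seq R) : size (l1 ++ l2) = #|FT|.+1 ->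
    {in l1, forall w, S w /\ homogeneous rho w} -> {in l2, forall w, S w} ->
    \prod_(w <- l1) w * \prod_(w <- l2) w = 0.
  by move=> l sl lS; have := gen l [::] sl; rewrite big_nil mul1r; apply.
elim: l2 l1 => [|w l2 IH] l1 sl l1P l2S.
  by rewrite cats0 in sl; rewrite homogeneous_nil ?mul0r ?sl.
have [s sP ->] := homogeneous_decomposition rho_lin rho1 rhoM S0 SD Srho (l2S w (mem_head _ _)).
rewrite big_cons mulrA mulr_sumr mulr_suml big_seq big1 // => v vs.
have := IH (rcons l1 v); rewrite -cats1 big_cat big_seq1 /=; apply.
- by rewrite -sl -catA !size_cat.
- by move=> t; rewrite mem_cat inE => /orP[/l1P//|/eqP->]; apply: sP.
- by move=> t tl; apply: l2S; rewrite inE tl orbT.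
Qed.

End GradedNilpotent.
End Eigen.

(** * Monomials of the bosonization *)

Section Proportional.
Context (K : fieldType) (A : algType K).
Implicit Types a b c : A.

(** The generators are exchanged up to nonzero scalars; recording only this lets words be reordered
    freely when vanishing is at stake. *)
Definition proportional a b : Prop := exists2 k : K, k != 0 & a = k *: b.

Lemma proportional_refl a : proportional a a.
Proof. by exists 1; rewrite ?oner_neq0 ?scale1r. Qed.

Lemma proportional_sym a b : proportional a b -> proportional b a.
Proof. by move=> [k k0 ->]; exists k^-1; rewrite ?invr_neq0 // scalerA mulVf ?scale1r. Qed.

Lemma proportional_trans a b c : proportional a b -> proportional b c -> proportional a c.
Proof. by move=> [k k0 ->] [l l0 ->]; exists (k * l); rewrite ?mulf_neq0 ?scalerA. Qed.

Lemma proportional_mull c a b : proportional a b -> proportional (c * a) (c * b).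
Proof. by move=> [k k0 ->]; exists k; rewrite // scalerAr. Qed.

Lemma proportional_mulr c a b : proportional a b -> proportional (a * c) (b * c).
Proof. by move=> [k k0 ->]; exists k; rewrite // scalerAl. Qed.

End Proportional.

Section WordTheory.
Context (K : fieldType) (gT : finGroupType) (theta : nat).
Context (g : 'I_theta -> gT) (chi : 'I_theta -> gT -> K) (m : 'I_theta -> nat).
Context (B : algType K) (u : gT -> B) (x : 'I_theta -> B).
Hypotheses (datum : qls_datum g chi m) (rel : qls_relations g chi m u x).
Implicit Types (s : seq 'I_theta) (i j : 'I_theta).

Local Notation xs := (word_prod x).

Lemma word_prod_cons i s : xs (i :: s) = x i * xs s.
Proof. exact: big_cons. Qed.

Lemma word_prod_cat s s' : xs (s ++ s') = xs s * xs s'.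
Proof. exact: big_cat. Qed.

Lemma character_neq0 (f : gT -> K) a : is_character f -> f a != 0.
Proof.
move=> [f1 fM]; apply/eqP => f0; have /eqP := f1.
by rewrite -(mulgV a) fM f0 mul0r eq_sym oner_eq0.
Qed.

Lemma x_prop i j : proportional (x i * x j) (x j * x i).
Proof.
case: (eqVneq i j) => [->|ij]; first exact: proportional_refl.
exists (chi j (g i)); last exact: (qls_xx rel).
exact: character_neq0 (qls_character datum j).
Qed.

Lemma x_word_prop i s : proportional (x i * xs s) (xs s * x i).
Proof.
elim: s => [|j s IH]; first by rewrite /word_prod big_nil mulr1 mul1r; apply: proportional_refl.
rewrite word_prod_cons mulrA -[X in proportional _ X]mulrA.
apply: proportional_trans (proportional_mulr _ (x_prop i j)) _.
by rewrite -mulrA; apply: proportional_mull.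
Qed.

Lemma u_word_prop a s : proportional (u a * xs s) (xs s * u a).
Proof.
elim: s => [|j s IH]; first by rewrite /word_prod big_nil mulr1 mul1r; apply: proportional_refl.
rewrite word_prod_cons mulrA -[X in proportional _ X]mulrA.
apply: (@proportional_trans _ _ _ (x j * u a * xs s)).
  apply: proportional_mulr; exists (chi j a); last exact: (qls_ux rel).
  exact: character_neq0 (qls_character datum j).
by rewrite -mulrA; apply: proportional_mull.
Qed.

Lemma word_rem i s : i \in s -> proportional (xs s) (xs (i :: rem i s)).
Proof.
elim: s => [//|j s IH]; rewrite inE /= eq_sym.
case: eqVneq => [->|ji] /= is_; first exact: proportional_refl.
rewrite !word_prod_cons mulrA.
apply: proportional_trans (proportional_mull _ (IH is_)) _.
by rewrite word_prod_cons mulrA; apply/proportional_mulr/x_prop.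
Qed.

Lemma word_perm s s' : perm_eq s s' -> proportional (xs s) (xs s').
Proof.
elim: s s' => [|i s IH] s' ss'.
  by move/perm_size/esym/size0nil: ss' => ->; apply: proportional_refl.
have is' : i \in s' by rewrite -(perm_mem ss') mem_head.
apply: proportional_trans (proportional_sym (word_rem is')).
rewrite !word_prod_cons; apply/proportional_mull/IH.
by rewrite -(perm_cons i) (permPl ss') perm_to_rem.
Qed.

(** Reordering the word brings out the factor [x i ^+ m i]. *)
Lemma word_overflow i s : (m i <= count_mem i s)%N -> xs s = 0.
Proof.
move=> ci; have : perm_eq s (nseq (count_mem i s) i ++ filter (predC (pred1 i)) s).
  have <- : filter (pred1 i) s = nseq (count_mem i s) i.
    by rewrite -size_filter; apply/all_pred1P/filter_all.
  by rewrite perm_sym perm_filterC.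
move=> /word_perm[k _ ->]; rewrite word_prod_cat /word_prod big_nseq -/(iterop _ _ _ _).
have -> : iter (count_mem i s) ( *%R (x i)) 1 = x i ^+ count_mem i s.
  by elim: (count_mem i s) => //= c ->; rewrite exprS.
by rewrite -(subnKC ci) exprD (qls_x_nil rel) !mul0r scaler0.
Qed.

End WordTheory.

(** * The action on a module algebra *)

Section Action.
Context (K : fieldType) (gT : finGroupType) (n : nat).
Context (g : 'I_n.+1 -> gT) (chi : 'I_n.+1 -> gT -> K) (m : 'I_n.+1 -> nat).
Context (B : hopfAlgType K) (u : gT -> B) (x : 'I_n.+1 -> B).
Hypotheses (datum : qls_datum g chi m) (isB : is_qls_bosonization g chi m u x).
Context (R : modAlgType B).
Implicit Types (s : seq 'I_n.+1) (i j : 'I_n.+1) (r v w : R) (a b : gT).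

Let rel := qls_rel isB.
Local Notation xs := (word_prod x).
Local Notation gam a := (hact (u a) : R -> R).
Local Notation del i := (hact (x i) : R -> R).
Local Notation act s := (hact (xs s) : R -> R).

Let hb := @hact_bilin K B R.

Lemma hact_lin (h : B) : linear (hact h : R -> R).
Proof. by move=> k r r'; rewrite (bilin_Dr hb) (bilin_Zr hb). Qed.

Lemma hactD (h : B) : {morph (hact h : R -> R) : r r' / r + r'}.
Proof. exact: bilin_Dr hb h. Qed.
Lemma hactZ (h : B) k r : hact h (k *: r) = k *: hact h r.
Proof. exact: bilin_Zr hb k h r. Qed.
Lemma hact0 (h : B) : hact h 0 = 0 :> R.
Proof. exact: bilin_0r hb h. Qed.
Lemma hactB (h : B) r r' : hact h (r - r') = hact h r - hact h r'.
Proof. by rewrite hactD -scaleN1r hactZ scaleN1r. Qed.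

Lemma hact_prop (h h' : B) r : proportional h h' -> proportional (hact h r) (hact h' r).
Proof. by move=> [k k0 ->]; exists k; rewrite // (bilin_Zl hb). Qed.

Lemma proportional_eq0 (A : algType K) (a b : A) : proportional a b -> b = 0 -> a = 0.
Proof. by move=> [k _ ->] ->; rewrite scaler0. Qed.

Let mul_bilin r r' : bilin (fun h1 h2 : B => hact h1 r * hact h2 r').
Proof.
by apply: bilinI => *; rewrite ?(bilin_Dl hb, bilin_Zl hb) ?(mulrDl, mulrDr) //
  -?(scalerAl, scalerAr).
Qed.

Lemma gamM a r r' : gam a (r * r') = gam a r * gam a r'.
Proof.
have [cu _] := qls_grouplike isB a.
by rewrite hact_mul /sweedler cu tlift_pure //; apply: mul_bilin.
Qed.

Lemma delM i r r' : del i (r * r') = gam (g i) r * del i r' + del i r * r'.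
Proof.
have cx := qls_skew_primitive isB i; rewrite /skew_primitive in cx.
have mb := mul_bilin r r'.
by rewrite hact_mul /sweedler cx tliftD // !tlift_pure // hact1.
Qed.

Lemma gam_act1 r : gam 1%g r = r.
Proof. by rewrite (qls_u1 rel) hact1. Qed.

Lemma gam_actM a b r : gam (a * b)%g r = gam a (gam b r).
Proof. by rewrite (qls_uM rel) hactM. Qed.

Lemma gamK a : cancel (gam a) (gam a^-1%g).
Proof. by move=> r; rewrite -gam_actM mulVg gam_act1. Qed.
Lemma gamVK a : cancel (gam a^-1%g) (gam a).
Proof. by move=> r; rewrite -gam_actM mulgV gam_act1. Qed.

Lemma gam_one a : gam a 1 = 1.
Proof. by have [_ cu] := qls_grouplike isB a; rewrite hact_one cu scale1r. Qed.

Lemma del_one i : del i 1 = 0.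
Proof.
have := delM i 1 1; rewrite !mulr1 gam_one mul1r => e.
by apply: (addrI (del i 1)); rewrite addr0 -e.
Qed.

Lemma gam_del a i r : gam a (del i r) = chi i a *: del i (gam a r).
Proof. by rewrite -!hactM (qls_ux rel) (bilin_Zl hb). Qed.

Lemma del_gam_eq0 a i r : del i r = 0 -> del i (gam a r) = 0.
Proof.
move=> d0; have /eqP := gam_del a i r; rewrite d0 hact0 eq_sym scaler_eq0.
by rewrite (negPf (character_neq0 _ (qls_character datum i))) => /eqP.
Qed.

Lemma act_cons i s r : act (i :: s) r = del i (act s r).
Proof. by rewrite word_prod_cons hactM. Qed.

Lemma act_nil r : act [::] r = r.
Proof. by rewrite /word_prod big_nil hact1. Qed.

Lemma act_cat s s' r : act (s ++ s') r = act s (act s' r).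
Proof. by rewrite word_prod_cat hactM. Qed.

Lemma act_perm s s' r : perm_eq s s' -> proportional (act s r) (act s' r).
Proof. by move=> ss'; apply/hact_prop/(word_perm datum rel). Qed.

Lemma act_overflow i s r : (m i <= count_mem i s)%N -> act s r = 0.
Proof. by move=> /(word_overflow datum rel) ->; apply: bilin_0l hb r. Qed.

Lemma del_act i s r : proportional (del i (act s r)) (act s (del i r)).
Proof. by rewrite -!hactM; apply/hact_prop/(x_word_prop datum rel). Qed.

Lemma gam_act a s r : proportional (gam a (act s r)) (act s (gam a r)).
Proof. by rewrite -!hactM; apply/hact_prop/(u_word_prop datum rel). Qed.

(** If x_i kills [r], the Leibniz rule gives [r * del i v = del i (r' * v)] with [r'] the translate
    of [r] by the inverse of [g i], so [r] moves through the word one letter at a time. *)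
Lemma mul_act s r v : {in s, forall i, del i r = 0} ->
  exists a, r * act s v = act s (gam a r * v).
Proof.
elim: s r => [|i s IH] r r0; first by exists 1%g; rewrite !act_nil gam_act1.
pose r' := gam (g i)^-1%g r.
have r'0 : {in s, forall j, del j r' = 0}.
  by move=> j js; apply/del_gam_eq0/r0; rewrite inE js orbT.
have [a e] := IH r' r'0; exists (a * (g i)^-1)%g.
rewrite !act_cons gam_actM -e delM gamVK.
by rewrite [X in _ + X * _]del_gam_eq0 ?mul0r ?addr0 // r0 ?mem_head.
Qed.

Lemma act_mul s r v : {in s, forall i, del i v = 0} -> act s (r * v) = act s r * v.
Proof.
elim: s => [|i s IH] v0; first by rewrite !act_nil.
rewrite !act_cons IH => [|j js]; last by apply: v0; rewrite inE js orbT.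
by rewrite delM v0 ?mem_head // mulr0 add0r.
Qed.

(* The ring R_k of the header. *)
Definition tail_inv k : set R := [set r | forall j, (k <= j)%N -> del j r = 0].

Lemma tail_inv_gam k a r : tail_inv k r -> tail_inv k (gam a r).
Proof. by move=> rk j kj; apply/del_gam_eq0/rk. Qed.

Lemma tail_inv_del k i r : tail_inv k r -> tail_inv k (del i r).
Proof.
move=> rk j kj; rewrite -hactM; apply: proportional_eq0 (hact_prop _ (x_prop datum rel j i)) _.
by rewrite hactM rk // hact0.
Qed.

Lemma tail_inv_act k s r : tail_inv k r -> tail_inv k (act s r).
Proof. by move=> rk; elim: s => [|i s IH]; rewrite ?act_nil // act_cons; apply: tail_inv_del. Qed.

Lemma tail_inv_subring k : subring_set (tail_inv k).
Proof.
split=> [j _|r v rk vk j kj|r v rk vk j kj]; first exact: del_one.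
  by rewrite hactB rk // vk // subrr.
by rewrite delM rk // vk // mul0r mulr0 addr0.
Qed.

Lemma tail_invS k : tail_inv k `<=` tail_inv k.+1.
Proof. by move=> r rk j kj; apply/rk/ltnW. Qed.

Lemma tail_invP i r : tail_inv i.+1 r -> del i r = 0 -> tail_inv i r.
Proof. by move=> rk r0 j; rewrite leq_eqVlt => /orP[/eqP/val_inj <-|/rk]. Qed.

(** The monomial t_k; [inord k'] is the index [k'] itself as long as [k <= n.+1]. *)
Fixpoint top_word k : seq 'I_n.+1 :=
  if k is k'.+1 then top_word k' ++ nseq (m (inord k')).-1 (inord k') else [::].

Lemma count_top_word k i : (k <= n.+1)%N ->
  count_mem i (top_word k) = if (i < k)%N then (m i).-1 else 0%N.
Proof.
elim: k => [//|k IH] kn /=; rewrite count_cat IH; last exact: ltnW.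
rewrite count_nseq /= [in RHS]ltnS [in RHS]leq_eqVlt.
have -> : (inord k == i :> 'I_n.+1) = (i == k :> nat).
  by rewrite -(inj_eq val_inj) /= inordK // eq_sym.
case: eqVneq => [<-|_] /=; last by rewrite ?mul0n addn0.
by rewrite ltnn ?mul1n add0n inord_val.
Qed.

Lemma m_gt0 i : (0 < m i)%N.
Proof. by apply: leq_trans (qls_order_ge2 datum i). Qed.

(** For [j < k] a further x_j overflows the word; for [k <= j] it passes through the word up to a
    scalar and kills [r]. *)
Lemma top_word_inv k r : (k <= n.+1)%N -> tail_inv k r -> tail_inv 0 (act (top_word k) r).
Proof.
move=> kn rk j _; case: (ltnP j k) => [jk|kj].
  rewrite -act_cons; apply: (@act_overflow j).
  by rewrite /= eqxx count_top_word // jk add1n prednK ?m_gt0.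
by apply: proportional_eq0 (del_act _ _ _) _; rewrite rk // hact0.
Qed.

(* The largest left ideal of tail_inv k that is killed by the word s. *)
Definition killed k s : set R :=
  [set v | tail_inv k v /\ forall r, tail_inv k r -> act s (r * v) = 0].

Lemma killed_gam k s a v : killed k s v -> killed k s (gam a v).
Proof.
move=> [vk sv]; split=> [|r rk]; first exact: tail_inv_gam.
rewrite -[r](gamVK a) -gamM; apply: proportional_eq0 (proportional_sym (gam_act _ _ _)) _.
by rewrite sv ?hact0 //; apply: tail_inv_gam.
Qed.

(** Solving the Leibniz rule for [r * del i v] leaves a derivative of a multiple of [v] and a
    multiple of [v]. *)
Lemma killed_del k s i v : killed k s v -> killed k s (del i v).
Proof.
move=> [vk sv]; split=> [|r rk]; first exact: tail_inv_del.
have r'k : tail_inv k (gam (g i)^-1%g r) by apply: tail_inv_gam.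
have -> : r * del i v = del i (gam (g i)^-1%g r * v) - del i (gam (g i)^-1%g r) * v.
  by rewrite delM gamVK addrK.
rewrite hactB sv ?subr0; last exact: tail_inv_del.
by apply: proportional_eq0 (proportional_sym (del_act _ _ _)) _; rewrite sv // hact0.
Qed.

End Action.

(** * Nondegeneracy of the top monomial *)

Section Trace.
Context (K : fieldType) (gT : finGroupType) (n : nat).
Context (g : 'I_n.+1 -> gT) (chi : 'I_n.+1 -> gT -> K) (m : 'I_n.+1 -> nat).
Context (B : hopfAlgType K) (u : gT -> B) (x : 'I_n.+1 -> B).
Hypotheses (datum : qls_datum g chi m) (isB : is_qls_bosonization g chi m u x).
Context (R : modAlgType B).
Implicit Types (s : seq 'I_n.+1) (i : 'I_n.+1) (j : nat) (r v w : R) (a b : gT).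

Local Notation gam a := (hact (u a) : R -> R).
Local Notation del i := (hact (x i) : R -> R).
Local Notation act s := (hact (word_prod x s) : R -> R).
Local Notation tail_inv := (@tail_inv _ _ _ x R).

Lemma act_nseq j i r : act (nseq j i) r = iter j (del i) r.
Proof. by elim: j => [|j IH] /=; rewrite ?act_nil // act_cons IH. Qed.

Lemma gam_exp a j r : gam (a ^+ j)%g r = iter j (gam a) r.
Proof. by elim: j => [|j IH] /=; rewrite ?(gam_act1 isB) // expgS (gam_actM isB) IH. Qed.

Let q i : K := chi i (g i).

Lemma del_gam_iter i j r :
  del i (iter j (gam (g i)) r) = (q i)^-1 ^+ j *: iter j (gam (g i)) (del i r).
Proof.
have q0 : q i != 0 by apply: character_neq0 (qls_character datum i).
elim: j r => [|j IH] r; first by rewrite scale1r.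
rewrite iterSr IH exprSr -scalerA iterSr (gam_del isB) -/(q i); congr (_ *: _).
elim: j {IH} => [|j IH]; first by rewrite /= scalerA mulVf ?scale1r.
by rewrite /= IH hactZ.
Qed.

(* The q-Leibniz formula, truncated by the hypothesis on v. *)
Lemma iter_del_mul i j v w : del i (del i v) = 0 ->
  iter j.+1 (del i) (v * w) =
  iter j.+1 (gam (g i)) v * iter j.+1 (del i) w +
  (\sum_(l < j.+1) (q i)^-1 ^+ l) *:
    (iter j (gam (g i)) (del i v) * iter j (del i) w).
Proof.
move=> dv; elim: j => [|j IH]; first by rewrite big_ord_recl big_ord0 addr0 scale1r /= (delM isB).
rewrite iterS {}IH hactD hactZ !(delM isB) !del_gam_iter dv.
rewrite [iter j _ 0](_ : _ = 0); last by elim: (j) => //= l ->; rewrite hact0.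
rewrite scaler0 mul0r addr0 [in RHS]big_ord_recr /= scalerDl -addrA -scalerAl.
by congr (_ + _); rewrite addrC.
Qed.

(** A zero sum would give [q i] an order dividing [j.+1], which is less than [m i]. *)
Lemma qnum_neq0 i j : (j.+1 < m i)%N -> \sum_(l < j.+1) (q i)^-1 ^+ l != 0.
Proof.
move=> jm; apply/eqP => s0; have := subrX1 (q i)^-1 j.+1; rewrite s0 mulr0 => /eqP.
rewrite subr_eq0 exprVn invr_eq1 -(prim_order_dvd (qls_order datum i)) => /(dvdn_leq (ltn0Sn _)).
by rewrite leqNgt jm.
Qed.

Section Step.
Context (k : 'I_n.+1).
Hypothesis sp0 : semiprime (tail_inv 0).
Hypothesis hypk : forall L : set R, left_ideal (tail_inv k.+1) L -> L <> [set 0] ->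
  del k @` L <> [set 0].
Hypothesis IH : forall L : set R, left_ideal (tail_inv k) L -> forall l, L l -> l <> 0 ->
  exists2 l', L l' & act (top_word m k) l' <> 0.

Local Notation D := (del k).
Local Notation Q := (tail_inv k.+1).
Let V := @killed _ _ _ x R k.+1 (nseq (m k).-1 k).
Let N : set R := [set v | V v /\ D v = 0].

Let iterE j r : iter j D r = act (nseq j k) r.
Proof. by rewrite act_nseq. Qed.

Let iter_mul j r v : N v -> iter j D (r * v) = iter j D r * v.
Proof.
move=> [_ Dv]; rewrite !iterE (act_mul isB) // => i /nseqP[-> _]; exact: Dv.
Qed.

Let iter_big j r v : Q r -> N v -> ((m k).-1 <= j)%N -> iter j D r * v = 0.
Proof.
move=> Qr Nv mj; rewrite -iter_mul // -(subnK mj) iterD.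
have [[_ sv] _] := Nv; rewrite [X in iter _ _ X]iterE sv //.
by elim: (j - _)%N => //= l ->; rewrite hact0.
Qed.

Let N_gam a v : N v -> N (gam a v).
Proof.
move=> [Vv Dv]; split; first exact: (killed_gam datum isB).
exact: (del_gam_eq0 datum isB).
Qed.

Let N_del i v : N v -> N (del i v).
Proof.
move=> [Vv Dv]; split; first exact: (killed_del datum isB).
rewrite -hactM; apply: proportional_eq0 (hact_prop _ (x_prop datum (qls_rel isB) k i)) _.
by rewrite hactM Dv hact0.
Qed.

Let Q_iter j r : Q r -> Q (iter j D r).
Proof. by move=> Qr; rewrite iterE; apply: (tail_inv_act datum isB). Qed.

Let Q_sub := tail_inv_subring isB R k.+1.

Lemma killed_step v : V v -> v = 0.
Proof.
move=> Vv; apply: contrapT => v0.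
(* The last nonzero iterate of [D] on [v] lies in [N]. *)
have [n0 Nn0 n00] : exists2 n0, N n0 & n0 <> 0.
  have exj : exists j, iter j D v == 0.
    by exists (m k); rewrite iterE (act_overflow datum isB (i := k)) // count_nseq /= eqxx mul1n.
  case: (ex_minnP exj) => [[|j]] /eqP jv jmin; first by case: v0.
  exists (iter j D v); last by move=> /eqP/jmin; rewrite ltnn.
  by split=> //; elim: j {jv jmin} => //= j; apply: (killed_del datum isB).
have [Q1 QB QM] := Q_sub.
pose P e := `[< exists r v, [/\ Q r, N v & iter e D r * v <> 0] >].
(* [D] does not kill the left ideal [Q n0], and [D (r * n0) = D r * n0] as [n0] is in [N]. *)
have P1 : P 1%N.
  pose L : set R := [set r * n0 | r in Q].
  have Ln0 : L n0 by exists 1; rewrite ?mul1r.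
  have [[Qn0 _] Dn0] := Nn0.
  have idL : left_ideal Q L.
    split.
    - by move=> _ [r Qr <-]; apply: QM.
    - by exists 0; rewrite ?mul0r // -(subrr 1); apply: QB.
    - by move=> _ _ [r Qr <-] [r' Qr' <-]; exists (r - r'); rewrite ?mulrBl //; apply: QB.
    - by move=> s _ Qs [r Qr <-]; exists (s * r); rewrite ?mulrA //; apply: QM.
  have L0 : L <> [set 0] by move=> L0; apply: n00; rewrite L0 in Ln0.
  apply/asboolP; apply: contrapT => noP; apply: (hypk idL L0); apply/seteqP; split.
    move=> _ [_ [r Qr <-] <-]; apply: contrapT => D0; apply: noP; exists r, n0; split=> //.
    by move: D0; rewrite -iter_mul.
  by move=> _ ->; exists 0; [have [] := idL|rewrite hact0].
have maxP e : P e -> (e <= (m k).-1)%N.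
  move=> /asboolP[r [w [Qr Nw rw]]]; rewrite leqNgt; apply/negP => me.
  by apply: rw; apply: iter_big (ltnW me).
case: (ex_maxnP (ex_intro (fun e => is_true (P e)) _ P1) maxP).
move=> e /asboolP[r1 [n1 [Qr1 Nn1 rn1]]] emax.
have e_max e' r w : (e < e')%N -> Q r -> N w -> iter e' D r * w = 0.
  move=> ee' Qr Nw; apply: contrapT => rw; move: ee'; rewrite ltnNge; apply/negP/negPn.
  by apply: emax; apply/asboolP; exists r, w.
have e_gt0 : (0 < e)%N by apply: emax.
have e_lt : (e.+1 < m k)%N.
  rewrite -ltn_predRL ltnNge; apply/negP => me; apply: rn1; exact: iter_big.
(* Translating by the inverse of [b] compensates the [iter e (gam (g k))] of the Leibniz formula for
   [A * (r' * w')]. The left side and the first term on the right vanish by maximality of [e]. *)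
have ortho r w r' w' : Q r -> N w -> Q r' -> N w' ->
    (iter e D r * w) * (iter e D r' * w') = 0.
  move=> Qr Nw Qr' Nw'; pose b := (g k ^+ e)%g.
  pose r2 := gam b^-1%g r; pose w2 := gam b^-1%g w.
  have Qr2 : Q r2 by apply: (tail_inv_gam datum isB).
  have Nw2 : N w2 by apply: N_gam.
  pose A := iter e.-1 D r2 * w2.
  have DA : D A = iter e D r2 * w2 by rewrite -[D A]/(iter 1 D A) iter_mul // -iterD add1n prednK.
  have DDA : D (D A) = 0.
    by rewrite DA -[D _]/(iter 1 D _) iter_mul // -iterD add1n e_max.
  have QA : Q A by apply: QM; [apply: Q_iter|have [[]] := Nw2].
  have := iter_del_mul e (r' * w') DDA.
  rewrite mulrA (iter_mul _ (A * r') Nw') !(iter_mul _ r' Nw') e_max ?ltnSn //; last exact: QM.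
  rewrite [X in _ = _ * X + _]e_max ?ltnSn // mulr0 add0r => /esym/eqP.
  rewrite scaler_eq0 (negPf (qnum_neq0 e_lt)) /= -gam_exp DA => /eqP.
  have [c c0 e1] : proportional (gam b (iter e D r2)) (iter e D r).
    rewrite -[in X in proportional _ X](gamVK isB b r) !iterE; exact: (gam_act datum isB).
  rewrite (gamM isB) -/b e1 (gamVK isB) -!scalerAl => /eqP.
  by rewrite scaler_eq0 (negPf c0) => /eqP.
(* The sums over [P0] are stable under all x_i and multiply to zero, so their images under words
   still multiply to zero. *)
pose P0 : set R := [set iter e D r * w | r in Q & w in N].
have P0_del i : forall y, sums P0 y -> sums P0 (del i y).
  apply: sums_ind => [|y z|_ [r Qr [w Nw <-]]].
  - by rewrite hact0; apply: sums0.
  - by rewrite hactD; apply: sumsD.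
  rewrite (delM isB); apply: sumsD; apply: sums1.
    have [c _ e1] : proportional (gam (g i) (iter e D r)) (iter e D (gam (g i) r)).
      by rewrite !iterE; apply: (gam_act datum isB).
    exists (gam (g i) (c *: r)).
      by apply/(tail_inv_gam datum isB) => j kj; rewrite hactZ Qr ?scaler0.
    by exists (del i w); [apply: N_del|rewrite e1 iterE !hactZ -iterE].
  have [c _ e1] : proportional (del i (iter e D r)) (iter e D (del i r)).
    by rewrite !iterE; apply: (del_act datum isB).
  exists (del i (c *: r)).
    by apply/(tail_inv_del datum isB) => j kj; rewrite hactZ Qr ?scaler0.
  by exists w; rewrite // e1 iterE !hactZ -iterE.
have P0_act s y : sums P0 y -> sums P0 (act s y).
  by move=> Py; elim: s => [|i s IHs]; rewrite ?act_nil // act_cons; apply: P0_del.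
have P0_sq y y' : sums P0 y -> sums P0 y' -> y * y' = 0.
  move=> Py Py'; elim/sums_ind: y / Py; first by rewrite mul0r.
    by move=> a b; rewrite mulrDl => -> ->; rewrite addr0.
  move=> _ [r Qr [w Nw <-]]; elim/sums_ind: y' / Py'; first by rewrite mulr0.
    by move=> a b; rewrite mulrDr => -> ->; rewrite addr0.
  by move=> _ [r' Qr' [w' Nw' <-]]; apply: ortho.
(* With the right factor [n1] fixed, this set is itself additive, and maximality of [e] puts it in
   [tail_inv k]. *)
pose L1 : set R := [set iter e D r * n1 | r in Q].
have L1_mul w y : tail_inv k w -> L1 y -> L1 (w * y).
  move=> kw [r Qr <-].
  have [|a e1] := mul_act datum isB (s := nseq e k) (r := w) r.
    by move=> i /nseqP[-> _]; apply: kw.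
  exists (gam a w * r); last by rewrite mulrA !iterE e1.
  by apply: QM => //; apply: (tail_inv_gam datum isB); apply: tail_invS.
have L1_ideal : left_ideal (tail_inv k) L1.
  split=> //.
  - move=> _ [r Qr <-]; apply: tail_invP; last first.
      by rewrite -[D _]/(iter 1 D _) iter_mul // -iterD add1n e_max.
    by apply: QM; [apply: Q_iter|have [[]] := Nn1].
  - by exists 0; rewrite ?iterE ?hact0 ?mul0r // => j _; rewrite hact0.
  - move=> _ _ [r Qr <-] [r' Qr' <-]; exists (r - r'); first exact: QB.
    by rewrite ?iterE ?hactB ?mulrBl.
have [y Ly y0] : exists2 l, L1 l & act (top_word m k) l <> 0.
  apply: (IH L1_ideal (l := iter e D r1 * n1)) => //; by exists r1.
have L1P0 l : L1 l -> sums P0 l by move=> [r Qr <-]; apply: sums1; exists r => //; exists n1.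
have kn : (k <= n.+1)%N by apply: ltnW.
apply: y0.
apply: (@semiprime_nil _ _ (act (top_word m k) @` L1) _ (tail_inv_subring isB R 0) sp0).
- have [L1k _ _ _] := L1_ideal.
  by move=> _ [l /L1k kl <-]; apply: (top_word_inv datum isB).
- move=> s _ s0 [l Ll <-].
  have [|a e1] := mul_act datum isB (s := top_word m k) (r := s) l; first by move=> i _; apply: s0.
  rewrite e1; exists (gam a s * l) => //; apply: L1_mul => //.
  by apply: (tail_inv_gam datum isB) => i _; apply: s0.
- exists 2%N => f fL; rewrite big_ord_recl big_ord_recl big_ord0 mulr1.
  have [l Ll <-] := fL ord0; have [l' Ll' <-] := fL (lift ord0 ord0).
  by apply: P0_sq; apply/P0_act/L1P0.
- by exists y.
Qed.
End Step.

(** By [killed_step] some [r * l] in [L] survives the power [(m i).-1] of x_i. That power maps [L]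
    onto a left ideal of [tail_inv i], to which the induction hypothesis applies. *)
Lemma top_word_nondegenerate k (L : set R) l :
  semiprime (tail_inv 0) ->
  (forall (i : 'I_n.+1) (L : set R), left_ideal (tail_inv i.+1) L -> L <> [set 0] ->
    del i @` L <> [set 0]) ->
  (k <= n.+1)%N -> left_ideal (tail_inv k) L -> L l -> l <> 0 ->
  exists2 l', L l' & act (top_word m k) l' <> 0.
Proof.
move=> sp0 hyp; elim: k L l => [|k IH] L l kn idL Ll l0; first by exists l; rewrite ?act_nil.
pose i : 'I_n.+1 := inord k; have ik : i = k :> nat by rewrite inordK.
have IHi L' : left_ideal (tail_inv i) L' -> forall l, L' l -> l <> 0 ->
    exists2 l', L' l' & act (top_word m i) l' <> 0.
  by rewrite ik => idL' l1; apply: IH => //; apply: ltnW.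
have idLi : left_ideal (tail_inv i.+1) L by rewrite ik.
have [LQ L0 LB LM] := idLi.
have [r [Qr rl0]] : exists r, tail_inv i.+1 r /\ act (nseq (m i).-1 i) (r * l) <> 0.
  apply: contrapT => nor; apply: l0; apply: (killed_step sp0 (hyp i) IHi).
  split=> [|r Qr]; first exact: LQ.
  by apply: contrapT => rl0; apply: nor; exists r.
pose L' : set R := act (nseq (m i).-1 i) @` L.
have idL' : left_ideal (tail_inv i) L'.
  split.
  - move=> _ [v /LQ Qv <-]; apply: tail_invP; first exact: (tail_inv_act datum isB).
    rewrite -act_cons (act_overflow datum isB (i := i)) //= eqxx count_nseq /= eqxx mul1n.
    by rewrite add1n prednK // (m_gt0 datum).
  - by exists 0; rewrite ?hact0.
  - by move=> _ _ [v Lv <-] [w Lw <-]; exists (v - w); rewrite ?hactB //; apply: LB.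
  - move=> r' _ r'i [v Lv <-].
    have [|a e1] := mul_act datum isB (s := nseq (m i).-1 i) (r := r') v.
      by move=> j /nseqP[-> _]; apply: r'i.
    exists (gam a r' * v) => //; apply: LM => //.
    by apply: (tail_inv_gam datum isB); apply: tail_invS.
have [|_ [v Lv <-] tv0] := IHi _ idL' _ _ rl0.
  by exists (r * l) => //; apply: LM.
by exists v => //; rewrite /= act_cat -/i -ik.
Qed.

End Trace.

(** * The smash product *)

Section SmashTheory.
Context (K : fieldType) (H : hopfAlgType K) (R : modAlgType H).
Implicit Types (r : R) (h : H) (t : smash R).

Definition smash_inl r : smash R := r ⊗ 1.
Definition smash_inr h : smash R := 1 ⊗ h.

Let pb := @pure_bilin K R H.
Let hb := @hact_bilin K H R.

Let sb1 := @smash_bilin1 K H R.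

Lemma smash_inl_pure r r' h' : smash_inl r * (r' ⊗ h' : smash R) = (r * r') ⊗ h'.
Proof. by rewrite [_ * _]smash_mulE sweedler1 ?hact1 ?mul1r //; apply: sb1. Qed.

Lemma smash_inlM r r' : smash_inl (r * r') = smash_inl r * smash_inl r'.
Proof. by rewrite smash_inl_pure. Qed.

Lemma smash_pureE r h : r ⊗ h = smash_inl r * smash_inr h.
Proof. by rewrite smash_inl_pure mulr1. Qed.

Lemma smash_pure_inr r h h' : (r ⊗ h : smash R) * smash_inr h' = r ⊗ (h * h').
Proof.
rewrite [_ * _]smash_mulE -[in RHS](counitl h).
have lG : linear (fun k => r ⊗ (k * h') : tens R H).
  by move=> a k k'; rewrite mulrDl (bilin_Dr pb) -scalerAl (bilin_Zr pb).
rewrite [RHS](tlift_morph _ _ lG); apply: eq_tlift => h1 h2.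
by rewrite hact_one -scalerAr mulr1 -scalerAl (bilin_Zl pb) (bilin_Zr pb).
Qed.

Lemma smash_inrM h h' : smash_inr (h * h') = smash_inr h * smash_inr h'.
Proof. by rewrite smash_pure_inr. Qed.

Lemma smash_inr1 : smash_inr 1 = 1.
Proof. by []. Qed.

Lemma smash_scalel (a : K) t t' : (a *: t) * t' = a *: (t * t').
Proof. exact: (linear_Z (smash_mulPl t')). Qed.

Lemma smash_scaler (a : K) t t' : t * (a *: t') = a *: (t * t').
Proof. exact: (linear_Z (smash_mulPr t)). Qed.

Lemma smash_inr_lin : linear smash_inr.
Proof. by move=> a h h'; rewrite /smash_inr (bilin_Dr pb) (bilin_Zr pb). Qed.

Lemma smash_inl_lin : linear smash_inl.
Proof. by move=> a r r'; rewrite /smash_inl (bilin_Dl pb) (bilin_Zl pb). Qed.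

Lemma smash_inlD r r' : smash_inl (r + r') = smash_inl r + smash_inl r'.
Proof. exact: (linear_D smash_inl_lin). Qed.

Lemma smash_inl0 : smash_inl 0 = 0.
Proof. exact: (linear_0 smash_inl_lin). Qed.

Lemma smash_inrZ a h : smash_inr (a *: h) = a *: smash_inr h.
Proof. exact: (linear_Z smash_inr_lin). Qed.

Lemma smash_inr0 : smash_inr 0 = 0.
Proof. exact: (linear_0 smash_inr_lin). Qed.

Lemma smash_inr_grouplike h r : grouplike h ->
  smash_inr h * smash_inl r = smash_inl (hact h r) * smash_inr h.
Proof.
move=> [ch _]; rewrite [LHS]smash_mulE /sweedler ch tlift_pure ?mul1r ?mulr1 ?smash_pureE //.
Qed.

Lemma smash_inr_skew c h r : skew_primitive c 1 h ->
  smash_inr h * smash_inl r = smash_inl (hact c r) * smash_inr h + smash_inl (hact h r).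
Proof.
move=> ch; rewrite /skew_primitive in ch.
have b1 := sb1 1 r 1.
by rewrite [LHS]smash_mulE /sweedler ch tliftD // !tlift_pure // !mul1r !mulr1 -smash_pureE.
Qed.

Lemma smash_ind (P : smash R -> Prop) : P 0 -> (forall t t', P t -> P t' -> P (t + t')) ->
  (forall r h, P (smash_inl r * smash_inr h)) -> forall t, P t.
Proof.
move=> P0 PD Pp; elim/tens_ind => [//|r h t Pt]; apply: PD => //; rewrite smash_pureE; exact: Pp.
Qed.

End SmashTheory.

(** * Semiprimeness of the smash product *)

Section SmashSemiprime.
Context (K : closedFieldType) (gT : finGroupType) (n : nat).
Context (g : 'I_n.+1 -> gT) (chi : 'I_n.+1 -> gT -> K) (m : 'I_n.+1 -> nat).
Context (B : hopfAlgType K) (u : gT -> B) (x : 'I_n.+1 -> B).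
Hypothesis char0 : [pchar K] =i pred0.
Hypotheses (datum : qls_datum g chi m) (isB : is_qls_bosonization g chi m u x).
Context (R : modAlgType B).
Implicit Types (s : seq 'I_n.+1) (i : 'I_n.+1) (r v w : R) (a b : gT) (lam : gT -> K).

Local Notation gam a := (hact (u a) : R -> R).
Local Notation del i := (hact (x i) : R -> R).
Local Notation xs := (word_prod x).
Local Notation act s := (hact (xs s) : R -> R).
Local Notation tail_inv := (@tail_inv _ _ _ x R).
Local Notation inl := (@smash_inl K B R).
Local Notation inr := (@smash_inr K B R).
Local Notation T := (smash R).

Let rel := qls_rel isB.
Let topw := top_word m n.+1.
Let top := xs topw.

Let count_topw i : count_mem i topw = (m i).-1.
Proof. by rewrite count_top_word // ltn_ord. Qed.

Lemma inr_u a r : inr (u a) * inl r = inl (gam a r) * inr (u a).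
Proof. exact/smash_inr_grouplike/(qls_grouplike isB). Qed.

Lemma inr_x i r : inr (x i) * inl r = inl (gam (g i) r) * inr (x i) + inl (del i r).
Proof. exact/smash_inr_skew/(qls_skew_primitive isB). Qed.

Lemma x_top i : x i * top = 0.
Proof.
rewrite -word_prod_cons; apply: (word_overflow datum rel (i := i)).
by rewrite /= eqxx count_topw add1n prednK // (m_gt0 datum).
Qed.

(** Since x_i kills [top] from the left, the term of the commutation rule in which x_i moves past
    [r] disappears. *)
Lemma word_top s r : inr (xs s) * inl r * inr top = inl (act s r) * inr top.
Proof.
elim: s => [|i s IH].
  by rewrite act_nil /word_prod big_nil smash_inr1 mul1r.
rewrite word_prod_cons hactM smash_inrM -!mulrA [_ * (_ * inr top)]mulrA IH mulrA inr_x.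
by rewrite mulrDl -mulrA -smash_inrM x_top smash_inr0 mulr0 add0r.
Qed.

Lemma trivial_character : is_character (fun _ : gT => 1 : K).
Proof. by split=> // *; rewrite mulr1. Qed.

Lemma top_char_free lam r : is_character lam ->
  inl r * inr (top * char_elt u lam) = 0 -> r = 0.
Proof.
move=> lamP; rewrite -smash_pureE; exact: (pure_top_eq0 char0 datum isB lamP count_topw).
Qed.

Lemma top_free r : inl r * inr top = 0 -> r = 0.
Proof.
(* Multiply on the right by the sum of all elements of [G]. *)
move=> r0; apply: (top_char_free trivial_character).
by rewrite smash_inrM mulrA r0 mul0r.
Qed.

Lemma u_top_prop a : proportional (u a * top) (top * u a).
Proof. exact: (u_word_prop datum rel). Qed.

Lemma setT_subring (A : pzRingType) : subring_set [set: A].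
Proof. by []. Qed.

(** * Necessity of the conditions *)

Lemma smash_killed (V : set R) v0 : semiprime [set: T] ->
  (forall a v, V v -> V (gam a v)) -> (forall i v, V v -> V (del i v)) ->
  V v0 -> (forall r v, V v -> v0 * act topw (r * v) = 0) -> v0 = 0.
Proof.
move=> spT Vg Vd Vv0 tV; apply: top_free.
apply: (semiprime_elem (setT_subring _) spT) => // t _.
(* The letters of [b], from the last one on, are absorbed into [v * top] up to a right factor, which
   replaces [v] by [gam a v] or [del i v], still in [V]. *)
have main (b : B) : forall v r, V v ->
    inl v0 * inr top * inl r * inr b * inl v * inr top = 0.
  move: b; apply: (qls_ind isB) => [v r Vv|c b b' IH IH' v r Vv|b a IH v r Vv|b i IH v r Vv].
  - rewrite smash_inr1 mulr1 -[_ * inl r * _]mulrA -smash_inlM -!mulrA [inr top * _]mulrA.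
    by rewrite word_top mulrA -smash_inlM tV // smash_inl0 mul0r.
  - have -> : inr (c *: b + b') = c *: inr b + inr b' by apply: smash_inr_lin.
    by rewrite mulrDr !mulrDl smash_scaler !smash_scalel IH // IH' // scaler0 addr0.
  - rewrite smash_inrM !mulrA -[_ * inr (u a) * _]mulrA inr_u.
    have [c c0 uc] := u_top_prop a.
    rewrite -!mulrA -smash_inrM uc smash_inrZ !smash_scaler smash_inrM !mulrA.
    by rewrite IH ?mul0r ?scaler0 //; apply: Vg.
  - rewrite smash_inrM !mulrA -[_ * inr (x i) * _]mulrA inr_x mulrDr mulrDl !mulrA.
    rewrite IH ?addr0; last exact: Vd.
    by rewrite -mulrA -smash_inrM x_top smash_inr0 mulr0.
move: t; apply: smash_ind => [|t t' e e'|r h]; first by rewrite mulr0 mul0r.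
  by rewrite mulrDr mulrDl e e' addr0.
by rewrite !mulrA main.
Qed.

Lemma semiprime_inv : semiprime [set: T] -> semiprime (tail_inv 0).
Proof.
move=> spT I idI nI; have [[IS I0 IB IM] IMr] := idI.
apply/seteqP; split=> [i Ii /=|_ ->//]; apply: contrapT => i0.
pose F a : set R := [set gam a r | r in I].
have idF a : two_sided_ideal (tail_inv 0) (F a).
  split; [split|].
  - by move=> _ [r Ir <-]; apply/(tail_inv_gam datum isB)/IS.
  - by exists 0; rewrite ?hact0.
  - by move=> _ _ [r Ir <-] [r' Ir' <-]; exists (r - r'); rewrite ?hactB //; apply: IB.
  - move=> s _ Ss [r Ir <-]; exists (gam a^-1%g s * r); last by rewrite (gamM isB) (gamVK isB).
    by apply: IM => //; apply: (tail_inv_gam datum isB).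
  - move=> s _ Ss [r Ir <-]; exists (r * gam a^-1%g s); last by rewrite (gamM isB) (gamVK isB).
    by apply: IMr => //; apply: (tail_inv_gam datum isB).
have gam_prod a (l : seq R) : gam a (\prod_(r <- l) r) = \prod_(r <- l) gam a r.
  by elim: l => [|v l IH]; rewrite ?big_nil ?(gam_one isB) // !big_cons (gamM isB) IH.
have nF a : nilpotent_ideal (F a).
  have /nilpotent_idealP[k nk] := nI; apply/nilpotent_idealP; exists k => l sl lF.
  apply: (can_inj (gamK isB a^-1%g)); rewrite hact0 gam_prod.
  have <- : \prod_(r <- map (gam a^-1%g) l) r = \prod_(r <- l) gam a^-1%g r by rewrite big_map.
  apply: nk; rewrite ?size_map //.
  by move=> _ /mapP[_ /lF [r Ir <-] ->]; rewrite (gamK isB).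
(* The sum of all translates is still nilpotent, and is stable under [G]. *)
pose J : set R := [set r | exists2 f, (forall a, F a (f a)) & r = \sum_(a <- enum gT) f a].
have nJ : nilpotent_ideal J by apply: (nilpotent_ideal_sum _ (tail_inv_subring isB R 0)).
have JI : J `<=` tail_inv 0.
  move=> _ [f fF ->] j _; rewrite (big_morph _ (hactD (x j)) (hact0 _ (x j))).
  by apply: big1 => a _; have [r Ir <-] := fF a; apply: (tail_inv_gam datum isB _ (IS _ Ir)).
have Ji : J i.
  exists (fun a => if a == 1%g then i else 0) => [a|].
    by case: eqVneq => [->|_]; [exists i; rewrite ?(gam_act1 isB)|exists 0; rewrite ?hact0].
  by rewrite big_enum /= -big_mkcond big_pred1_eq.
have JM r v : tail_inv 0 r -> J v -> J (r * v).
  move=> r0 [f fF ->]; exists (fun a => r * f a); last by rewrite mulr_sumr.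
  by move=> a; have [[_ _ _ FM] _] := idF a; apply: FM.
have Jgam b v : J v -> J (gam b v).
  move=> [f fF ->]; exists (fun a => gam b (f (b^-1 * a)%g)).
    by move=> a; have [r Ir <-] := fF (b^-1 * a)%g; exists r; rewrite // -(gam_actM isB) mulKVg.
  rewrite (big_morph _ (hactD (u b)) (hact0 _ (u b))) !big_enum /=.
  by rewrite [RHS](reindex_inj (mulgI b)); apply: eq_bigr => a _; rewrite mulKg.
have [p [l [sl lJ l0 nl]]] := nilpotent_top nJ Ji i0.
set k := \prod_(a <- l) a in l0.
have k_inv : tail_inv 0 k.
  have [S1 _ SM] := tail_inv_subring isB R 0.
  rewrite /k; elim: {sl nl k l0} l lJ => [|v l IH] lJ; first by rewrite big_nil.
  rewrite big_cons; apply: SM; first by apply/JI/lJ; rewrite mem_head.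
  by apply: IH => w wl; apply: lJ; rewrite inE wl orbT.
(* [k] lies in [V], for [k * r * gam a k] is a product of more elements of [J] than the maximal
   length allows. *)
pose V : set R := [set v | tail_inv 0 v /\ forall r a, tail_inv 0 r -> k * r * gam a v = 0].
apply: l0; apply: (@smash_killed V) => //.
- move=> a v [v0 Vv]; split=> [|r b r0]; first exact: (tail_inv_gam datum isB).
  by rewrite -(gam_actM isB) Vv.
- move=> j v [v0 Vv]; rewrite v0 //; split=> [j' _|r a _]; by rewrite hact0 ?mulr0.
- split=> // r a r0; rewrite /k; case: l sl lJ nl {k k_inv V} => [//|v l] sl lJ nl.
  have -> : (\prod_(w <- v :: l) w) * r * gam a (\prod_(w <- v :: l) w) =
      \prod_(w <- (v :: l) ++ (r * gam a v) :: map (gam a) l) w.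
    by rewrite big_cat /= gam_prod !big_cons big_map !mulrA.
  apply: nl; first by rewrite size_cat sl /= size_map addnS !ltnS leq_addr.
  move=> w; rewrite mem_cat inE => /or3P[/lJ//|/eqP->|/mapP[w' w'l ->]].
    by apply: JM => //; apply/Jgam/lJ; rewrite mem_head.
  by apply/Jgam/lJ; rewrite inE w'l orbT.
- move=> r v [v0 Vv]; rewrite (act_mul isB) // => [|j _]; last exact: v0.
  rewrite mulrA -[v](gam_act1 isB) Vv //.
  by apply: (top_word_inv datum isB) => // j; rewrite leqNgt ltn_ord.
Qed.

Lemma semiprime_del_neq0 (k : 'I_n.+1) (L : set R) : semiprime [set: T] ->
  left_ideal (tail_inv k.+1) L -> L <> [set 0] -> del k @` L <> [set 0].
Proof.
move=> spT [LQ L0 LB LM] Lneq dL; apply: Lneq; apply/seteqP; split=> [l Ll /=|_ ->//].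
apply: (@smash_killed (killed x k.+1 [:: k])) => //.
- by move=> a v; apply: (killed_gam datum isB).
- by move=> i v; apply: (killed_del datum isB).
- split=> [|r Qr]; first exact: LQ.
  rewrite act_cons act_nil.
  have : (del k @` L) (del k (r * l)) by exists (r * l) => //; apply: LM.
  by rewrite dL.
move=> r v [Qv kv].
(* The letters above [k] act first: they kill [v], so they act on [r] alone and send it into
   [tail_inv k.+1]. A letter [k] then kills the product by [kv]. *)
pose s1 := filter (fun j : 'I_n.+1 => (k < j)%N) topw.
pose s0 := filter (predC (fun j : 'I_n.+1 => (k < j)%N)) topw.
have ks0 : k \in s0.
  rewrite mem_filter /= ltnn -has_pred1 has_count count_topw -ltnS prednK ?(m_gt0 datum) //.
  exact: qls_order_ge2 datum k.
have pW : perm_eq topw ((rem k s0 ++ [:: k]) ++ s1).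
  rewrite perm_sym perm_catC perm_sym -(perm_filterC (fun j : 'I_n.+1 => (k < j)%N)).
  by rewrite perm_cat2l perm_sym perm_catC perm_sym; apply: perm_to_rem.
rewrite (proportional_eq0 (act_perm datum isB _ pW)) ?mulr0 //.
rewrite !act_cat (act_mul isB) => [|j]; last by rewrite mem_filter => /andP[kj _]; apply: Qv.
rewrite kv ?hact0 // => j kj; rewrite -act_cons.
apply: (act_overflow datum isB (i := j)); rewrite /= eqxx count_filter.
rewrite (@eq_count _ _ (pred1 j)) ?count_topw ?add1n ?prednK ?(m_gt0 datum) // => i /=.
by case: eqVneq => // ->.
Qed.

(** * Character sums and top terms in the smash product *)

Lemma x_char_elt lam i :
  char_elt u lam * x i = x i * char_elt u (fun a => lam a * chi i a^-1%g).
Proof.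
rewrite mulr_suml mulr_sumr; apply: eq_bigr => a _.
by rewrite -scalerAl (qls_ux rel) invgK scalerA -scalerAr.
Qed.

Lemma mul_characterV lam i : is_character lam ->
  is_character (fun a => lam a * chi i a^-1%g).
Proof.
move=> [l1 lM]; have [c1 cM] := qls_character datum i; split=> [|a b].
  by rewrite l1 invg1 c1 mulr1.
have -> : ((a * b)^-1 = a^-1 * b^-1)%g.
  by rewrite -invMg; congr (_^-1)%g; apply: (centsP (qls_abelian datum)); rewrite inE.
by rewrite lM cM mulrACA.
Qed.

Lemma mul_character lam i : is_character lam -> is_character (fun a => lam a * chi i a).
Proof.
move=> [l1 lM]; have [c1 cM] := qls_character datum i; split=> [|a b].
  by rewrite l1 c1 mulr1.
by rewrite lM cM mulrACA.
Qed.

Lemma char_elt_x lam i :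
  x i * char_elt u lam = char_elt u (fun a => lam a * chi i a) * x i.
Proof.
rewrite x_char_elt; congr (_ * _); apply: eq_bigr => a _.
have [c1 cM] := qls_character datum i.
by rewrite invgK -mulrA -cM mulVg c1 mulr1.
Qed.

Lemma char_elt_word lam s : is_character lam ->
  exists2 lam', is_character lam' & char_elt u lam * xs s = xs s * char_elt u lam'.
Proof.
elim: s lam => [|i s IH] lam lamP; first by exists lam; rewrite // /word_prod big_nil mul1r mulr1.
have [lam' lamP' e] := IH _ (mul_characterV i lamP).
by exists lam'; rewrite // word_prod_cons mulrA x_char_elt -[LHS]mulrA e mulrA.
Qed.

Lemma u_char_elt lam a : is_character lam -> u a * char_elt u lam = lam a *: char_elt u lam.
Proof.
move=> [l1 lM]; rewrite mulr_sumr scaler_sumr [RHS](reindex_inj (mulgI a)) /=.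
apply: eq_bigr => b _; rewrite -scalerAr -(qls_uM rel) scalerA; congr (_ *: _).
rewrite -lM; congr (lam _).
have abb : (a * b = b * a)%g by apply: (centsP (qls_abelian datum)); rewrite inE.
by rewrite abb invMg mulKVg.
Qed.

Definition word_span lam : set T :=
  sums [set t | exists r s, t = inl r * inr (xs s * char_elt u lam)].

(** Group elements at the end of [b] become scalars in front of [char_elt]; a letter [x i] passes
    through it and changes the character, whence the induction over all [lam]. *)
Lemma word_span_inr lam r (b : B) : is_character lam ->
  word_span lam (inl r * inr (b * char_elt u lam)).
Proof.
move: b lam r; apply: (qls_ind isB) =>
  [lam r lamP|c b b' IH IH' lam r lamP|b a IH lam r lamP|b i IH lam r lamP].
- by apply: sums1; exists r, [::]; rewrite /word_prod big_nil.
- rewrite mulrDl -scalerAl (_ : inr _ = c *: inr (b * char_elt u lam) + inr (b' * char_elt u lam)).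
    rewrite mulrDr smash_scaler -smash_scalel; apply: sumsD; last exact: IH'.
    by rewrite -(linear_Z (@smash_inl_lin _ _ R)); apply: IH.
  exact: smash_inr_lin.
- rewrite -mulrA u_char_elt // -scalerAr smash_inrZ smash_scaler -smash_scalel.
  by rewrite -(linear_Z (@smash_inl_lin _ _ R)); apply: IH.
- rewrite -mulrA char_elt_x mulrA smash_inrM mulrA.
  move: (IH _ r (mul_character i lamP)).
  apply: (@sums_ind _ _ (fun t => word_span lam (t * inr (x i)))).
  + by rewrite mul0r; apply: sums0.
  + by move=> t t'; rewrite mulrDl; apply: sumsD.
  move=> _ [r' [s ->]]; apply: sums1; exists r', (rcons s i).
  by rewrite -mulrA -smash_inrM -mulrA -char_elt_x mulrA -cats1 word_prod_cat /word_prod big_seq1.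
Qed.

Lemma word_spanP lam t : is_character lam -> word_span lam (t * inr (char_elt u lam)).
Proof.
move=> lamP; move: t; apply: smash_ind => [|t t' wt wt'|r h].
- by rewrite mul0r; apply: sums0.
- by rewrite mulrDl; apply: sumsD.
by rewrite -mulrA -smash_inrM; apply: word_span_inr.
Qed.

Lemma word_complement s s' : (forall i, (count_mem i s <= count_mem i s')%N) ->
  exists s'', perm_eq (s ++ s'') s'.
Proof.
elim: s s' => [|i s IH] s' ss'; first by exists s'.
have is' : i \in s' by rewrite -has_pred1 has_count; apply: leq_trans (ss' i); rewrite /= eqxx.
have [|s'' ss''] := IH (rem i s').
  move=> j; rewrite -(leq_add2l (i == j)).
  by have /seq.permP/(_ (pred1 j)) /= <- := perm_to_rem is'; apply: ss'.
by exists s''; rewrite perm_sym (permPl (perm_to_rem is')) perm_sym /= perm_cons.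
Qed.

(** The terms whose word is a permutation of a shortest word [p0.2] are collected into one.
    Multiplying by the complement of [p0.2] in the top word turns it into a top term and kills all
    others. *)
Lemma word_span_top lam t : is_character lam -> word_span lam t -> t <> 0 ->
  exists s r lam', [/\ is_character lam', r <> 0
    & t * inr (xs s) = inl r * inr (top * char_elt u lam')].
Proof.
move=> lamP [l0 l0P ->].
have [l ->] : exists l : seq (R * seq 'I_n.+1),
    \sum_(b <- l0) b = \sum_(p <- l) inl p.1 * inr (xs p.2 * char_elt u lam).
  elim: l0 l0P => [|t0 l0 IH] l0P; first by exists [::]; rewrite !big_nil.
  have [|l e] := IH; first by move=> t' t'l; apply: l0P; rewrite inE t'l orbT.
  have [|r [s e']] := l0P t0; first exact: mem_head.
  by exists ((r, s) :: l); rewrite !big_cons e e'.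
have [N] := ubnP (size l); elim: N l => // N IH l lN t0.
have l_neq0 : exists k, has (fun p => size p.2 == k) l.
  case: l {lN} t0 => [|p l _]; first by rewrite big_nil.
  by exists (size p.2); rewrite /= eqxx.
case: (ex_minnP l_neq0) => k /hasP[p0 p0l /eqP sp0] kmin.
pose P (p : R * seq 'I_n.+1) := perm_eq p.2 p0.2.
have split : \sum_(p <- l) inl p.1 * inr (xs p.2 * char_elt u lam) =
    \sum_(p <- filter P l) inl p.1 * inr (xs p.2 * char_elt u lam) +
    \sum_(p <- filter (predC P) l) inl p.1 * inr (xs p.2 * char_elt u lam).
  by rewrite -big_cat; apply: perm_big; rewrite perm_sym perm_filterC.
have [r0 r0E] : exists r0, \sum_(p <- filter P l) inl p.1 * inr (xs p.2 * char_elt u lam) =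
    inl r0 * inr (xs p0.2 * char_elt u lam).
  have : all P (filter P l) by apply: filter_all.
  elim: (filter P l) => [_|p l' IHl /= /andP[Pp /IHl[r1 e]]].
    by exists 0; rewrite big_nil smash_inl0 mul0r.
  have [c _ ep] := word_perm datum rel Pp; exists (c *: p.1 + r1).
  rewrite big_cons e ep -scalerAl smash_inrZ smash_scaler -smash_scalel.
  by rewrite (@smash_inl_lin _ _ R) mulrDl.
(* If the collected term is zero it is dropped, and the list gets shorter as [p0] goes with it. *)
rewrite {}split in t0 *; have [z0|nz0] := pselect (inl r0 * inr (xs p0.2 * char_elt u lam) = 0).
  rewrite r0E z0 add0r in t0 *; apply: IH => //.
  rewrite ltnS in lN; apply: leq_trans lN.
  rewrite -(count_predC P l) size_filter -[ltnLHS]add0n ltn_add2r -has_count.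
  by apply/hasP; exists p0 => //; apply: perm_refl.
have c0 i : (count_mem i p0.2 <= count_mem i topw)%N.
  rewrite count_topw -ltnS prednK ?(m_gt0 datum) // ltnNge; apply/negP => ov.
  by apply: nz0; rewrite (word_overflow datum rel ov) mul0r smash_inr0 mulr0.
have [s sW] := word_complement c0.
have [lam' lamP' Ew] := char_elt_word s lamP.
have [c cn0 eW] := word_perm datum rel sW.
exists s, (c *: r0), lam'; split=> //.
  move=> /eqP; rewrite scaler_eq0 (negPf cn0) => /eqP r00; apply: nz0.
  by rewrite r00 smash_inl0 mul0r.
rewrite r0E mulrDl [X in _ + X](_ : _ = 0) ?addr0.
  rewrite -mulrA -smash_inrM -mulrA Ew mulrA -word_prod_cat eW -scalerAl smash_inrZ.
  by rewrite smash_scaler -smash_scalel -(linear_Z (@smash_inl_lin _ _ R)).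
rewrite mulr_suml big_seq big1 // => p; rewrite mem_filter => /andP[/= nP pl].
rewrite -mulrA -smash_inrM -mulrA Ew mulrA -word_prod_cat.
(* Otherwise the word would be contained in [p0.2] and, being no shorter, would be a permutation of
   it. *)
suff [i ci] : exists i, (count_mem i p0.2 < count_mem i p.2)%N.
  rewrite (word_overflow datum rel (i := i)) ?mul0r ?smash_inr0 ?mulr0 //.
  rewrite count_cat; apply: (@leq_trans ((count_mem i p0.2).+1 + count_mem i s)%N).
    2: by rewrite leq_add2r.
  by rewrite addSn -count_cat (seq.permP sW) count_topw prednK // (m_gt0 datum).
apply: contrapT => nolt; move/negP: nP; apply.
have [|s' ss'] := @word_complement p.2 p0.2.
  by move=> i; rewrite leqNgt; apply/negP => ci; apply: nolt; exists i.
have : (k <= size p.2)%N by apply: kmin; apply/hasP; exists p.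
rewrite -sp0 -(perm_size ss') size_cat -[leqRHS]addn0 leq_add2l leqn0 => /nilP s'0.
by rewrite s'0 cats0 in ss'.
Qed.

(** An eigenvector [w] in [J] for right multiplication by [G], of weight [lam], is only multiplied
    by [#|gT|] under [char_elt u lam]; a word then brings out a top term. *)
Lemma smash_square_zero_top (J : set T) : two_sided_ideal [set: T] J -> J <> [set 0] ->
  exists r lam, [/\ is_character lam, r <> 0 & J (inl r * inr (top * char_elt u lam))].
Proof.
move=> [[_ J0 JB JM] JMr] Jneq.
have [y Jy y0] : exists2 y, J y & y <> 0.
  apply: contrapT => noy; apply: Jneq; apply/seteqP; split=> [y Jy /=|_ ->//].
  by apply: contrapT => y0; apply: noy; exists y.
have JZ c t : J t -> J (c *: t) by move=> Jt; rewrite -[t]mul1r -smash_scalel; apply: JM.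
have JD c t t' : J t -> J t' -> J (c *: t + t').
  move=> Jt Jt'; rewrite -[t']opprK; apply: JB; first exact: JZ.
  by rewrite -scaleN1r; apply: JZ.
have gT_gt0 : (0 < #|gT|)%N by apply/card_gt0P; exists 1%g.
have [z zP] := closed_prim_root char0 gT_gt0.
pose rho a (t : T) : T := t * inr (u a).
have [||||s sP yE] :=
  homogeneous_decomposition char0 (qls_abelian datum) zP (rho := rho) _ _ _ J0 JD _ Jy.
- by move=> a c t t'; rewrite /rho mulrDl smash_scalel.
- by move=> t; rewrite /rho (qls_u1 rel) smash_inr1 mulr1.
- move=> a b t; rewrite /rho -mulrA -smash_inrM -(qls_uM rel).
  by congr (_ * inr (u _)); apply: (centsP (qls_abelian datum)); rewrite inE.
- by move=> a t Jt; apply: JMr.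
have [w [Jw [f fw] w0]] : exists w : T, [/\ J w, homogeneous z rho w & w <> 0].
  apply: contrapT => now; apply: y0; rewrite yE big_seq big1 // => w /sP[Jw hw].
  by apply: contrapT => w0; apply: now; exists w.
pose lam a := z ^+ f a.
have w_inj c : c *: w = 0 -> c = 0.
  by move=> /eqP; rewrite scaler_eq0 => /orP[/eqP//|/eqP].
have lamE a : lam a *: w = w * inr (u a) by rewrite -fw.
have lamP : is_character lam.
  split=> [|a b]; apply/eqP; rewrite -subr_eq0; apply/eqP/w_inj; rewrite scalerBl lamE.
    by rewrite (qls_u1 rel) smash_inr1 mulr1 scale1r subrr.
  by rewrite -scalerA lamE -smash_scalel lamE (qls_uM rel) smash_inrM mulrA subrr.
have wE : w * inr (char_elt u lam) = #|gT|%:R *: w.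
  rewrite /char_elt (big_morph inr (linear_D (@smash_inr_lin _ _ R)) (@smash_inr0 _ _ R)) mulr_sumr.
  rewrite (eq_bigr (fun=> w)) => [|a _]; first by rewrite sumr_const cardT -cardE scaler_nat.
  by rewrite smash_inrZ smash_scaler -lamE scalerA -lamP.2 mulVg lamP.1 scale1r.
have wE0 : w * inr (char_elt u lam) <> 0.
  rewrite wE => /w_inj /eqP; have /pcharf0P -> := char0; by rewrite gtn_eqF.
have [s' [r [lam' [lamP' r0 e]]]] := word_span_top lamP (word_spanP w lamP) wE0.
by exists r, lam'; split; rewrite // -e; apply: (JMr) => //; apply: JMr.
Qed.

(** * Sufficiency of the conditions *)

Lemma semiprime_smash : semiprime (tail_inv 0) ->
  (forall (i : 'I_n.+1) (L : set R), left_ideal (tail_inv i.+1) L -> L <> [set 0] ->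
    del i @` L <> [set 0]) ->
  semiprime [set: T].
Proof.
move=> sp0 hyp I idI nI; have [[_ I0 IB IM] IMr] := idI.
apply: contrapT => Ineq.
have [y Iy y0] : exists2 y, I y & y <> 0.
  apply: contrapT => noy; apply: Ineq; apply/seteqP; split=> [y Iy /=|_ ->//].
  by apply: contrapT => y0; apply: noy; exists y.
have [p [l [sl lI l0 nl]]] := nilpotent_top nI Iy y0.
(* The right annihilator of [I] within [I] has square zero and contains a nonzero product of maximal
   length. *)
pose J : set T := [set z | I z /\ forall t : T, I t -> t * z = 0].
have idJ : two_sided_ideal [set: T] J.
  split; [split|] => //.
  - by split=> // b _; rewrite mulr0.
  - by move=> a b [Ia Ja] [Ib Jb]; split; [apply: IB|move=> c Ic; rewrite mulrBr Ja // Jb // subrr].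
  - by move=> s a _ [Ia Ja]; split; [apply: IM|move=> c Ic; rewrite mulrA Ja //; apply: IMr].
  - by move=> s a _ [Ia Ja]; split; [apply: IMr|move=> c Ic; rewrite mulrA Ja // mul0r].
have Jl : J (\prod_(b <- l) b).
  split=> [|b Ib].
    case: l sl lI {l0 nl} => // b l _ lI; rewrite big_cons; apply: IMr => //.
    by apply: lI; rewrite mem_head.
  have := nl (b :: l); rewrite big_cons /= sl; apply=> // c.
  by rewrite inE => /orP[/eqP->//|]; apply: lI.
have Jneq : J <> [set 0] by move=> J0; apply: l0; rewrite J0 in Jl.
have [r0 [lam [lamP r00 Jr0]]] := smash_square_zero_top idJ Jneq.
pose E := char_elt u lam.
have [[_ J0 JB JM] JMr] := idJ.
pose L : set R := [set r | J (inl r * inr (top * E))].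
have u_topE a : exists2 c, c != 0 & u a * (top * E) = c *: (top * E).
  have [c c0 e] := u_top_prop a; exists (c * lam a).
    by rewrite mulf_neq0 // (character_neq0 _ lamP).
  by rewrite mulrA e -scalerAl -mulrA u_char_elt // -scalerAr scalerA.
have JZ c t : J t -> J (c *: t) by move=> Jt; rewrite -[t]mul1r -smash_scalel; apply: JM.
have L0 : L 0 by rewrite /L /= smash_inl0 mul0r.
have LB v w : L v -> L w -> L (v - w).
  move=> La Lb; rewrite /L /= smash_inlD -scaleN1r (linear_Z (@smash_inl_lin _ _ R)).
  by rewrite scaleN1r mulrBl; apply: JB.
have LM v w : L w -> L (v * w) by move=> Lb; rewrite /L /= smash_inlM -mulrA; apply: JM.
have Lgam a v : L v -> L (gam a v).
  move=> Lv; have [c c0 e] := u_topE a.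
  have : J (c^-1 *: (inr (u a) * (inl v * inr (top * E)))) by apply/JZ/JM.
  rewrite mulrA inr_u -mulrA -smash_inrM e smash_inrZ smash_scaler scalerA mulVf //.
  by rewrite scale1r.
have Ldel i v : L v -> L (del i v).
  move=> Lv; have : J (inr (x i) * (inl v * inr (top * E))) by apply: JM.
  by rewrite mulrA inr_x mulrDl -mulrA -smash_inrM mulrA x_top mul0r smash_inr0 mulr0 add0r.
have LZ c v : L v -> L (c *: v) by move=> Lv; rewrite -[v]mul1r scalerAl; apply: LM.
have LD c v w : L v -> L w -> L (c *: v + w).
  move=> Lv Lw; rewrite -[w]opprK; apply: LB; first exact: LZ.
  by rewrite -scaleN1r; apply: LZ.
have idL : left_ideal (tail_inv n.+1) L.
  by split=> // [v _ j|s v _]; [rewrite leqNgt ltn_ord|apply: LM].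
have [l' Ll' tl'0] := top_word_nondegenerate datum isB sp0 hyp (leqnn _) idL Jr0 r00.
pose S : set R := act topw @` L.
have S_inv : S `<=` tail_inv 0.
  move=> _ [v Lv <-]; apply: (top_word_inv datum isB) => // j; by rewrite leqNgt ltn_ord.
have SL : S `<=` L.
  move=> _ [v Lv <-]; elim: topw => [|i s IH]; rewrite ?act_nil // act_cons; exact: Ldel.
have SM r v : tail_inv 0 r -> S v -> S (r * v).
  move=> r_inv [w Lw <-].
  have [|a ->] := mul_act datum isB (s := topw) (r := r) w; first by move=> i _; apply: r_inv.
  by exists (gam a r * w) => //; apply: LM.
(* The scalar from exchanging [u a] and [top] also arises between [gam a] and [act topw], so only
   [lam a] remains. *)
have term a w : inr top * inr (u a) * inl w * inr (top * E) =
    lam a *: (inl (gam a (act topw w)) * inr (top * E)).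
  have [c _ e] := u_top_prop a.
  have -> : gam a (act topw w) = c *: act topw (gam a w).
    by rewrite -!hactM -/top e (bilin_Zl (@hact_bilin _ _ R)).
  rewrite -[_ * inl w]mulrA inr_u mulrA -[_ * inr (u a) * _]mulrA -smash_inrM.
  rewrite [u a * _]mulrA e -scalerAl -[top * u a * E]mulrA.
  rewrite [u a * E]u_char_elt // -scalerAr !smash_inrZ !smash_scaler smash_inrM !mulrA word_top.
  by rewrite (linear_Z (@smash_inl_lin _ _ R)) !smash_scalel scalerA [c * _]mulrC -scalerA.
have topE_sum t : inr (top * E) * t = \sum_a lam a^-1%g *: (inr top * inr (u a) * t).
  rewrite smash_inrM /E /char_elt.
  rewrite (big_morph inr (linear_D (@smash_inr_lin _ _ R)) (@smash_inr0 _ _ R)).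
  rewrite mulr_sumr mulr_suml; apply: eq_bigr => a _.
  by rewrite smash_inrZ smash_scaler smash_scalel.
(* The [lam a^-1] in [E] cancels the [lam a] of [term], which leaves the trace over [G]. *)
have trace_zero v w : L v -> L w -> v * (\sum_a gam a (act topw w)) = 0.
  move=> [Iv _] [_ Jw]; apply: (top_char_free lamP); rewrite -[RHS](Jw _ Iv).
  rewrite smash_inlM -!mulrA; congr (_ * _); rewrite -/E topE_sum.
  rewrite (big_morph inl (@smash_inlD _ _ R) (@smash_inl0 _ _ R)) mulr_suml.
  apply: eq_bigr => a _; rewrite [inr top * _ * _]mulrA term.
  by rewrite scalerA -lamP.2 mulVg lamP.1 scale1r.
apply: tl'0.
apply: (semiprime_nil (tail_inv_subring isB R 0) sp0 S_inv) => //; last by exists l'.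
have gT_gt0 : (0 < #|gT|)%N by apply/card_gt0P; exists 1%g.
have [z zP] := closed_prim_root char0 gT_gt0.
apply: (graded_nilpotent char0 (qls_abelian datum) zP (rho := fun a => gam a)).
- by move=> a; apply: hact_lin.
- by move=> v; apply: (gam_act1 isB).
- by move=> a b v; apply: (gam_actM isB).
- by move=> a v w; apply: (gamM isB).
- by exists 0; rewrite ?hact0.
- by move=> c _ _ [v Lv <-] [w Lw <-]; exists (c *: v + w); rewrite ?hactD ?hactZ //; apply: LD.
- move=> a _ [v Lv <-]; have [c c0 ->] := gam_act datum isB a topw v.
  by exists (c *: gam a v); rewrite ?hactZ //; apply/LZ/Lgam.
- by move=> s v /S_inv; apply: SM.
move=> s _ Ss [w Lw <-] fix_w.
(* On an invariant the trace is multiplication by [#|gT|], which is invertible. *)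
have := trace_zero s w (SL _ Ss) Lw.
rewrite (eq_bigr (fun=> act topw w)) => [|a _]; last exact: fix_w.
rewrite sumr_const cardT -cardE -scaler_nat -scalerAr => /eqP.
by have /pcharf0P cK := char0; rewrite scaler_eq0 cK gtn_eqF // => /eqP.
Qed.

End SmashSemiprime.

(** * Reordering the indices *)

Lemma qls_datum_perm (K : fieldType) (gT : finGroupType) theta (g : 'I_theta -> gT)
    (chi : 'I_theta -> gT -> K) (m : 'I_theta -> nat) (sigma : 'S_theta) :
  qls_datum g chi m -> qls_datum (g \o sigma) (chi \o sigma) (m \o sigma).
Proof.
move=> [abG ch ord ge2 br]; split=> [//|i|i|i|i j ij]; [exact: ch|exact: ord|exact: ge2|].
by apply: br; rewrite (inj_eq perm_inj).
Qed.

Lemma qls_relations_perm (K : fieldType) (gT : finGroupType) theta (g : 'I_theta -> gT)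
    (chi : 'I_theta -> gT -> K) (m : 'I_theta -> nat) (A : algType K)
    (u : gT -> A) (x : 'I_theta -> A) (sigma : 'S_theta) :
  qls_relations g chi m u x ->
  qls_relations (g \o sigma) (chi \o sigma) (m \o sigma) u (x \o sigma).
Proof.
move=> [u1 uM ux xn xx]; split=> [//|//|a i|i|i j ij]; [exact: ux|exact: xn|].
by apply: xx; rewrite (inj_eq perm_inj).
Qed.

Lemma qls_bosonization_perm (K : fieldType) (gT : finGroupType) theta (g : 'I_theta -> gT)
    (chi : 'I_theta -> gT -> K) (m : 'I_theta -> nat) (B : hopfAlgType K)
    (u : gT -> B) (x : 'I_theta -> B) (sigma : 'S_theta) :
  is_qls_bosonization g chi m u x ->
  is_qls_bosonization (g \o sigma) (chi \o sigma) (m \o sigma) u (x \o sigma).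
Proof.
move=> [rel ex un gl sk]; split=> [|A u' x' rel'|A f f' fu fx|//|i].
- exact: qls_relations_perm.
- have sK (S : Type) (h : 'I_theta -> S) : (h \o sigma) \o (sigma^-1)%g = h.
    by apply/funext => i /=; rewrite permKV.
  have := qls_relations_perm (sigma^-1)%g rel'; rewrite !sK => /ex[f [fu fx]].
  by exists f; split=> // i; rewrite /= [f _]fx /= permK.
- by apply: un => // i; have := fx ((sigma^-1)%g i); rewrite /= permKV.
- exact: sk.
Qed.

(* The rank theta is n.+1; the indices 1, ..., theta are the elements
   0, ..., n of 'I_n.+1, so that theta corresponds to ord_max. *)
Theorem theorem1 (K : closedFieldType) (char0 : [pchar K] =i pred0)
    (n : nat) (gT : finGroupType)
    (g : 'I_n.+1 -> gT) (chi : 'I_n.+1 -> gT -> K) (m : 'I_n.+1 -> nat)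
    (datum : qls_datum g chi m)
    (B : hopfAlgType K) (u : gT -> B) (x : 'I_n.+1 -> B)
    (isB : is_qls_bosonization g chi m u x)
    (R : modAlgType B) :
  semiprime [set: smash R] <->
  exists sigma : 'S_n.+1,
    [/\ semiprime (\bigcap_(i in [set: 'I_n.+1]) hact_ker R (x (sigma i))),
        forall L : set R, left_ideal [set: R] L -> L <> [set 0] ->
          hact (x (sigma ord_max)) @` L <> [set 0]
      & forall k : 'I_n.+1, (k < n)%N ->
          forall L : set R,
            left_ideal
              (\bigcap_(j in [set j : 'I_n.+1 | (k < j)%N])
                 hact_ker R (x (sigma j))) L ->
            L <> [set 0] -> hact (x (sigma k)) @` L <> [set 0]].
Proof.
have inv0 (sigma : 'S_n.+1) :
    \bigcap_(i in [set: 'I_n.+1]) hact_ker R (x (sigma i)) = tail_inv (x \o sigma) 0.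
  by apply/seteqP; split=> r rE j; [move=> _; apply: rE|move=> _; apply: (rE j)].
have invS (sigma : 'S_n.+1) (k : 'I_n.+1) :
    \bigcap_(j in [set j : 'I_n.+1 | (k < j)%N]) hact_ker R (x (sigma j)) =
    tail_inv (x \o sigma) k.+1.
  by apply/seteqP; split=> r rE j kj; apply: (rE j).
(* No index exceeds [ord_max], so condition (2) becomes the case [k = ord_max] of condition (3). *)
have invT (sigma : 'S_n.+1) : [set: R] = tail_inv (x \o sigma) (ord_max : 'I_n.+1).+1.
  by apply/seteqP; split=> // r _ j; rewrite leqNgt ltn_ord.
split=> [spT|[sigma [sp0 hypT hyp]]]; last first.
  apply: (semiprime_smash char0 (qls_datum_perm sigma datum) (qls_bosonization_perm sigma isB)).
    by rewrite -inv0.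
  move=> k L; case: (ltnP k n) => [kn|nk]; first by rewrite -invS; apply: hyp.
  have -> : k = ord_max by apply/val_inj/eqP; rewrite /= eqn_leq nk -ltnS ltn_ord.
  by rewrite -invT; apply: hypT.
(* Necessity holds for every order of the indices, so the identity will do. *)
pose sigma : 'S_n.+1 := 1%g.
have datum1 := qls_datum_perm sigma datum.
have isB1 := qls_bosonization_perm sigma isB.
exists sigma; split=> [|L|k _ L].
- by rewrite inv0; apply: (semiprime_inv char0 datum1 isB1).
- by rewrite (invT sigma); apply: (semiprime_del_neq0 char0 datum1 isB1).
- by rewrite invS; apply: (semiprime_del_neq0 char0 datum1 isB1).
Qed.
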